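(* Let $k\in\mathbb{N}$, $k\ge 1$, be fixed, and let $N=N(d)$ be integers with $N\ge d+1$ such that $\frac{d}{N}\to\frac12$ as $d\to\infty$. Then the Cover--Efron cones $C_N$ in $\mathbb{R}^d$ satisfy $$\lim_{d\to\infty}\frac{\mathbb{E} f_k(C_N)}{\binom{N}{k}}=1.$$
   Context: For each $d$, let $\phi=\phi_d$ be a probability measure on $\mathbb{R}^d$ which is even (i.e. $\phi(A)=\phi(-A)$ for Borel sets $A$) and assigns measure zero to each hyperplane through the origin. For $N\ge d+1$ let $X_1,\dots,X_N$ be independent random vectors with distribution $\phi$, and let $\mathrm{pos}$ denote the positive hull (set of all nonnegative linear combinations). The Cover--Efron cone $C_N$ is the random cone whose distribution is that of $\mathrm{pos}\{X_1,\dots,X_N\}$ conditioned on the event that this positive hull is different from $\mathbb{R}^d$. For a polyhedral convex cone $C\subset\mathbb{R}^d$ and $k\in\{1,\dots,d-1\}$ (so $d>k$ is understood), $f_k(C)$ denotes the number of $k$-dimensional faces of $C$. $\mathbb{E}$ denotes expectation. *)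

(* Defs.v *)
From HB Require Import structures.
From mathcomp Require Import all_boot all_order all_algebra finmap.
From mathcomp Require Import all_classical all_reals all_analysis.

Set Implicit Arguments.
Unset Strict Implicit.
Unset Printing Implicit Defensive.

Import Order.TTheory GRing.Theory Num.Theory.
Import numFieldNormedType.Exports.

Local Open Scope classical_set_scope.
Local Open Scope ring_scope.

(* R^d with its Borel sigma-algebra; vectors are rows. *)
Definition borel_rV (R : realType) (d : nat) :=
  g_sigma_algebraType (@open 'rV[R]_d).

Definition dotp (R : realType) (d : nat) (u x : 'rV[R]_d) : R :=
  \sum_(j < d) u 0 j * x 0 j.

(* The hyperplane through the origin with normal vector u (for u != 0). *)
Definition normal_hyperplane (R : realType) (d : nat) (u : 'rV[R]_d) :
    set 'rV[R]_d :=
  [set x | dotp u x = 0].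

Definition even_measure (R : realType) (d : nat)
    (phi : probability (borel_rV R d) R) : Prop :=
  forall A : set (borel_rV R d), measurable A ->
    phi A = phi ((fun x : 'rV[R]_d => - x) @` A).

Definition null_on_hyperplanes (R : realType) (d : nat)
    (phi : probability (borel_rV R d) R) : Prop :=
  forall u : 'rV[R]_d, u != 0 -> phi (normal_hyperplane u) = 0%E.

Definition mutually_independent (R : realType) (dsp dsp' : measure_display)
    (Omega : measurableType dsp) (T : measurableType dsp')
    (P : probability Omega R) (n : nat) (X : 'I_n -> {mfun Omega >-> T}) : Prop :=
  forall (J : {set 'I_n}) (B : 'I_n -> set T),
    (forall i, measurable (B i)) ->
    P (\bigcap_(i in [set` J]) (X i @^-1` B i)) =
    (\prod_(i in J) P (X i @^-1` B i))%E.

Definition has_law (R : realType) (dsp dsp' : measure_display)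
    (Omega : measurableType dsp) (T : measurableType dsp')
    (P : probability Omega R) (X : {mfun Omega >-> T})
    (mu : probability T R) : Prop :=
  forall B : set T, measurable B -> distribution P X B = mu B.

Definition pos (R : realType) (d n : nat) (x : 'I_n -> 'rV[R]_d) :
    set 'rV[R]_d :=
  [set y | exists2 c : 'I_n -> R,
     (forall i, 0 <= c i) & y = \sum_(i < n) c i *: x i].

(* Faces of a polyhedral cone C: its intersections with supporting hyperplanes
   (which pass through the origin, C being a cone) and, for u = 0, C itself. *)
Definition is_face (R : realType) (d : nat) (C F : set 'rV[R]_d) : Prop :=
  exists u : 'rV[R]_d,
    (forall x, C x -> dotp u x <= 0) /\ F = C `&` [set x | dotp u x = 0].

(* The linear hull of A has dimension k.  For a nonempty face of a cone the
   linear and the affine hull coincide, as the face contains the origin. *)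
Definition has_dim (R : realType) (d : nat) (A : set 'rV[R]_d) (k : nat) : Prop :=
  exists U : {vspace 'rV[R]_d},
    [/\ forall x, A x -> x \in U,
        forall V : {vspace 'rV[R]_d}, (forall x, A x -> x \in V) -> (U <= V)%VS
      & \dim U = k].

(* The set of faces of a polyhedral cone is finite, so that the default value
   of [fset_set] on infinite sets plays no role. *)
Definition face_number (R : realType) (d k : nat) (C : set 'rV[R]_d) : nat :=
  #|` fset_set [set F | is_face C F /\ has_dim F k] |.

(* Elementary conditional expectation given the event E. *)
Definition cond_expectation (R : realType) (dsp : measure_display)
    (Omega : measurableType dsp) (P : probability Omega R)
    (E : set Omega) (Y : Omega -> R) : \bar R :=
  ((\int[P]_(w in E) (Y w)%:E) / P E)%E.

(* The expectation of g(C_N), where the random cone C_N is distributed as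
   pos {X_1, ..., X_N} conditioned on this positive hull not being R^d. *)
Definition cover_efron_expectation (R : realType) (dsp : measure_display)
    (Omega : measurableType dsp) (P : probability Omega R) (d n : nat)
    (X : 'I_n -> {mfun Omega >-> borel_rV R d})
    (g : set 'rV[R]_d -> R) : \bar R :=
  let C := fun w : Omega => pos (fun i => X i w : 'rV[R]_d) in
  cond_expectation P [set w | C w <> [set: 'rV[R]_d]] (fun w => g (C w)).

(* Main.v *)
Require Import Defs.
From HB Require Import structures.
From mathcomp Require Import all_boot all_order all_algebra finmap.
From mathcomp Require Import all_classical all_reals all_analysis.
From mathcomp Require Import measurable_realfun zify ring lra.

Import Order.TTheory GRing.Theory Num.Theory.
Import numFieldNormedType.Exports.
Import HBNNSimple.

Local Open Scope classical_set_scope.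
Local Open Scope ring_scope.

Set Implicit Arguments.
Unset Strict Implicit.
Unset Printing Implicit Defensive.

(* Write [R A B] for the event that some linear functional vanishes on the
   vectors [X_i], [i \in A], and is positive on the [X_j], [j \in B].  In
   general position (which holds almost surely) and for [#|A| < d], flipping the
   sign of [X_j] turns [R A (j |: B)] into an event of the same probability; the
   union of both is [R A B], their intersection is [R (j |: A) B].  Hence
   [P (R A B)] satisfies Wendel's recursion and depends only on [#|B|] and
   [d - #|A|].  By Farkas' lemma [pos X] differs from R^d iff [R set0 setT]
   holds, and the k-faces of [pos X] correspond to the k-subsets [J] with
   [R J (~: J)].  Thus E f_k(C_N) / C(N, k) is the quotient of the Wendel
   probabilities with parameters (N - k, d - k) and (N, d).  It tends to 1,
   because C(n, m) is negligible against the sum of C(n, i), i < m, when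
   m / n -> 1/2. *)

(** * Linear algebra and Farkas' lemma *)

Lemma dotpDl (R : realType) d (u v x : 'rV[R]_d) :
  dotp (u + v) x = dotp u x + dotp v x.
Proof. by rewrite -big_split; apply: eq_bigr => j _; rewrite mxE mulrDl. Qed.

Lemma dotpZl (R : realType) d a (u x : 'rV[R]_d) :
  dotp (a *: u) x = a * dotp u x.
Proof. by rewrite mulr_sumr; apply: eq_bigr => j _; rewrite mxE mulrA. Qed.

Lemma dotpC (R : realType) d (u x : 'rV[R]_d) : dotp u x = dotp x u.
Proof. by apply: eq_bigr => j _; rewrite mulrC. Qed.

Lemma dotpNl (R : realType) d (u x : 'rV[R]_d) : dotp (- u) x = - dotp u x.
Proof. by rewrite -scaleN1r dotpZl mulN1r. Qed.

Lemma dotpDr (R : realType) d (u x y : 'rV[R]_d) :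
  dotp u (x + y) = dotp u x + dotp u y.
Proof. by rewrite dotpC dotpDl ![dotp u _]dotpC. Qed.

Lemma dotpZr (R : realType) d a (u x : 'rV[R]_d) :
  dotp u (a *: x) = a * dotp u x.
Proof. by rewrite dotpC dotpZl [dotp x u]dotpC. Qed.

Lemma dotpNr (R : realType) d (u x : 'rV[R]_d) : dotp u (- x) = - dotp u x.
Proof. by rewrite dotpC dotpNl dotpC. Qed.

Lemma dotp0r (R : realType) d (u : 'rV[R]_d) : dotp u 0 = 0.
Proof. by rewrite -(scale0r (0 : 'rV[R]_d)) dotpZr mul0r. Qed.

Lemma dotp0l (R : realType) d (u : 'rV[R]_d) : dotp 0 u = 0.
Proof. by rewrite dotpC dotp0r. Qed.

Lemma dotp_sumr (R : realType) d (I : Type) (r : seq I) (Q : pred I)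
    (u : 'rV[R]_d) (F : I -> 'rV[R]_d) :
  dotp u (\sum_(i <- r | Q i) F i) = \sum_(i <- r | Q i) dotp u (F i).
Proof. exact: (big_morph (dotp u) (dotpDr u) (dotp0r u)). Qed.

Lemma dotp_delta (R : realType) d (u : 'rV[R]_d) j :
  dotp u (delta_mx 0 j) = u 0 j.
Proof.
rewrite /dotp (bigD1 j)//= mxE !eqxx mulr1 big1 ?addr0// => i ij.
by rewrite mxE (negbTE ij) andbF mulr0.
Qed.

Lemma dotp_gt0 (R : realType) d (u : 'rV[R]_d) : u != 0 -> 0 < dotp u u.
Proof.
move=> u0; rewrite lt_neqAle sumr_ge0 ?andbT; last first.
  by move=> j _; rewrite -expr2 sqr_ge0.
apply: contraNneq u0 => /esym/eqP.
rewrite /dotp psumr_eq0 => [/allP u0|j _]; last by rewrite -expr2 sqr_ge0.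
apply/eqP/rowP => j; rewrite mxE.
by have := u0 j (mem_index_enum _); rewrite mulf_eq0 orbb => /eqP.
Qed.

(* Eliminates the last vector [z]: if a functional [u] separating [y] from the
   other vectors is negative at [z], shift all vectors along [z] into the
   kernel of [u] and recurse. *)
Lemma farkas (R : realType) d n (x : 'I_n -> 'rV[R]_d) (y : 'rV[R]_d) :
  ~ pos x y ->
  exists u, (forall i, 0 <= dotp u (x i)) /\ dotp u y < 0.
Proof.
elim: n => [|n IHn] in x y *.
  move=> yx; have y0 : y != 0.
    apply/eqP => y0; apply: yx; exists (fun=> 0) => //.
    by rewrite big_ord0.
  by exists (- y); split=> [[]//|]; rewrite dotpNl oppr_lt0 dotp_gt0.
move=> yx; pose x' i := x (lift ord_max i); pose z := x ord_max.
have posS c c0 w : (forall i, 0 <= c i) -> 0 <= c0 ->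
    w = \sum_i c i *: x' i + c0 *: z -> pos x w.
  move=> c_ge0 c0_ge0 ->.
  exists (fun i => if unlift ord_max i is Some j then c j else c0).
    by move=> i; case: unliftP.
  rewrite big_ord_recr /= unlift_none; congr (_ + _).
  apply: eq_bigr => i _.
  have -> : widen_ord (leqnSn n) i = lift ord_max i.
    by apply: val_inj; rewrite /= /bump leqNgt ltn_ord.
  by rewrite liftK.
have [|u [ux uy]] := IHn x' y.
  move=> [c c_ge0 yc]; apply: yx; apply: (posS c 0) => //.
  by rewrite scale0r addr0.
have [uz|uz] := leP 0 (dotp u z).
  exists u; split=> // i.
  by case: (unliftP ord_max i) => [j|] ->; [exact: ux|exact: uz].
have uz0 : dotp u z != 0 by rewrite lt_eqF.
pose l w := - (dotp u w / dotp u z).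
pose p w := w + l w *: z.
have up w : dotp u (p w) = 0 by rewrite /p /l dotpDr dotpZr; field.
have l_ge0 w : 0 <= dotp u w -> 0 <= l w.
  by move=> uw; rewrite oppr_ge0 mulr_ge0_le0// invr_le0 ltW.
have ly : l y < 0 by rewrite oppr_lt0 nmulr_rgt0// invr_lt0.
have [|v [vx vy]] := IHn (p \o x') (p y).
  move=> [c c_ge0 yc]; apply: yx.
  (* Expanding [p] in the representation of [p y] collects this coefficient of [z]; it is
     nonnegative because [l y < 0]. *)
  apply: (posS c (\sum_i c i * l (x' i) - l y)) => //.
    rewrite addr_ge0 ?oppr_ge0 ?(ltW ly)// sumr_ge0// => i _.
    by rewrite mulr_ge0// l_ge0.
  rewrite scalerBl scaler_suml addrA -big_split /=.
  under eq_bigr do rewrite -scalerA -scalerDr.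
  by rewrite -yc /p addrK.
(* A multiple of [u] corrects [v] to vanish at [z]; since [u] vanishes on the image of [p], the
   result equals [v] composed with [p]. *)
pose v' := v - (dotp v z / dotp u z) *: u.
have v'z : dotp v' z = 0 by rewrite /v' dotpDl dotpNl dotpZl; field.
have v'E w : dotp v' w = dotp v (p w).
  have -> : dotp v' w = dotp v' (p w) by rewrite dotpDr dotpZr v'z mulr0 addr0.
  by rewrite /v' dotpDl dotpNl dotpZl up mulr0 subr0.
exists v'; split=> [i|]; last by rewrite v'E.
case: (unliftP ord_max i) => [j|] ->; last by rewrite -/z v'z.
by rewrite v'E; exact: vx.
Qed.

(** Separating a missing vector from the cone gives [u] after a change of sign. Conversely, a cone
    equal to the whole space would contain [u], forcing [dotp u u <= 0]. *)
Lemma pos_neq_setT (R : realType) d n (x : 'I_n -> 'rV[R]_d) :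
  pos x <> [set: 'rV[R]_d] <->
  exists2 u, u != 0 & forall i, dotp u (x i) <= 0.
Proof.
split=> [/eqP/setTPn[y /farkas[u [ux uy]]]|[u u0 ux] xT].
  exists (- u) => [|i]; last by rewrite dotpNl oppr_le0.
  by apply: contraTneq uy => /eqP; rewrite oppr_eq0 => /eqP->; rewrite dotp0l ltxx.
have : pos x u by rewrite xT.
move=> [c c_ge0 uE].
have := dotp_gt0 u0; rewrite {2}uE dotp_sumr ltNge sumr_le0// => i _.
by rewrite dotpZr mulr_ge0_le0.
Qed.

(** Linear independence of the [x j], [j \in J], stated dually, since the arguments below need
    functionals with prescribed values. *)
Definition interpolates (R : realType) d n (J : {set 'I_n})
    (x : 'I_n -> 'rV[R]_d) : Prop :=
  forall t : 'I_n -> R, exists u, forall j, j \in J -> dotp u (x j) = t j.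

Definition rows_of (R : realType) d n (J : {set 'I_n})
    (x : 'I_n -> 'rV[R]_d) : 'M[R]_(#|J|, d) :=
  \matrix_(i, j) x (enum_val i) 0 j.

Lemma row_rows_of (R : realType) d n (J : {set 'I_n})
    (x : 'I_n -> 'rV[R]_d) i : row i (rows_of J x) = x (enum_val i).
Proof. by apply/rowP => j; rewrite !mxE. Qed.

Lemma mul_rows_of (R : realType) d n (J : {set 'I_n})
    (x : 'I_n -> 'rV[R]_d) (u : 'rV[R]_d) i :
  (rows_of J x *m u^T) i 0 = dotp u (x (enum_val i)).
Proof. by rewrite mxE; apply: eq_bigr => j _; rewrite !mxE mulrC. Qed.

(** Functionals dual to the vectors are the columns of a right inverse of the matrix, and a right
    inverse yields interpolating functionals. *)
Lemma interpolatesP (R : realType) d n (J : {set 'I_n})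
    (x : 'I_n -> 'rV[R]_d) : interpolates J x <-> row_free (rows_of J x).
Proof.
split=> [xJ|/row_freeP[B MB] t].
  have [U UP] := choice (fun i : 'I_#|J| => xJ (fun j => (enum_val i == j)%:R)).
  apply/row_freeP; exists (\matrix_(j, i) (U i) 0 j); apply/matrixP => i k.
  rewrite [RHS]mxE -(inj_eq enum_val_inj) eq_sym -UP ?enum_valP// mxE.
  by apply: eq_bigr => j _; rewrite !mxE mulrC.
pose c : 'cV_#|J| := \col_i t (enum_val i).
exists (B *m c)^T => j jJ; rewrite -(enum_rankK_in jJ jJ) -mul_rows_of.
by rewrite trmxK mulmxA MB mul1mx mxE.
Qed.

Lemma exists_orthogonal (R : realType) d n (J : {set 'I_n})
    (x : 'I_n -> 'rV[R]_d) : (#|J| < d)%N ->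
  exists2 u, u != 0 & forall j, j \in J -> dotp u (x j) = 0.
Proof.
move=> Jd; have : kermx (rows_of J x)^T != 0.
  rewrite kermx_eq0 /row_free mxrank_tr neq_ltn.
  by rewrite (leq_ltn_trans (rank_leq_row _)).
move=> /rowV0Pn[u /sub_kermxP uM u0]; exists u => // j jJ.
rewrite -(enum_rankK_in jJ jJ) -mul_rows_of.
by rewrite -[rows_of J x]trmxK -trmx_mul uM !mxE.
Qed.

Lemma sum_rows_of (R : realType) d n (J : {set 'I_n})
    (x : 'I_n -> 'rV[R]_d) (F : 'I_n -> R) :
  \sum_(j in J) F j *: x j = (\row_i F (enum_val i)) *m rows_of J x.
Proof.
rewrite mulmx_sum_row big_enum_val /=; apply: eq_bigr => i _.
by rewrite row_rows_of mxE.
Qed.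

Lemma interpolates_span (R : realType) d n (J : {set 'I_n})
    (x : 'I_n -> 'rV[R]_d) (y : 'rV[R]_d) : interpolates J x -> #|J| = d ->
  exists b : 'I_n -> R, y = \sum_(j in J) b j *: x j.
Proof.
move=> /interpolatesP; rewrite /row_free => /eqP rJ Jd.
have : row_full (rows_of J x) by rewrite /row_full rJ Jd.
move=> /row_fullP[B BM].
pose b j := \sum_i (enum_val i == j)%:R * (y *m B) 0 i.
exists b; rewrite sum_rows_of -[LHS]mulmx1 -BM mulmxA; congr (_ *m _).
apply/rowP => k; rewrite [RHS]mxE /b (bigD1 k)//= eqxx mul1r big1 ?addr0// => i ik.
by rewrite (inj_eq enum_val_inj) (negbTE ik) mul0r.
Qed.

Lemma interpolates_orthogonal (R : realType) d n (J : {set 'I_n})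
    (x : 'I_n -> 'rV[R]_d) u : interpolates J x -> #|J| = d ->
  (forall j, j \in J -> dotp u (x j) = 0) -> u = 0.
Proof.
move=> xJ Jd uJ; apply/eqP; apply/negPn/negP => /dotp_gt0.
have [b {2}->] := interpolates_span u xJ Jd.
rewrite dotp_sumr big1 ?ltxx// => j jJ.
by rewrite dotpZr uJ// mulr0.
Qed.

(** Replaces arbitrary values by finitely many open sign conditions, which makes independence
    measurable. Given a linear relation with coefficients [c], a functional whose signs match those
    of [c] makes all terms nonnegative with sum zero, so [c] vanishes on [J]. *)
Lemma interpolates_sign (R : realType) d n (J : {set 'I_n})
    (x : 'I_n -> 'rV[R]_d) :
  interpolates J x <->
  forall s : {ffun 'I_n -> bool}, exists u : 'rV[R]_d,
    forall j, j \in J -> 0 < (-1) ^+ s j * dotp u (x j).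
Proof.
split=> [xJ s|xJ].
  have [u uJ] := xJ (fun j => (-1) ^+ s j); exists u => j /uJ ->.
  by rewrite -signr_addb addbb.
apply/interpolatesP; rewrite -kermx_eq0.
apply/negPn/negP => /rowV0Pn[v /sub_kermxP vM /negP]; apply.
pose c j := \sum_i (enum_val i == j)%:R * v 0 i.
have cE i : c (enum_val i) = v 0 i.
  rewrite /c (bigD1 i)//= eqxx mul1r big1 ?addr0// => k ki.
  by rewrite (inj_eq enum_val_inj) (negbTE ki) mul0r.
have c0 : \sum_(j in J) c j *: x j = 0.
  rewrite sum_rows_of -[RHS]vM; congr (_ *m _).
  by apply/rowP => i; rewrite mxE cE.
have [u uJ] := xJ [ffun j => c j < 0].
have := dotp_sumr (index_enum _) (fun j => j \in J) u (fun j => c j *: x j).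
rewrite c0 dotp0r => /esym/eqP; rewrite psumr_eq0 => [/allP cJ|j jJ].
  apply/eqP/rowP => i; rewrite mxE -cE.
  have := cJ (enum_val i) (mem_index_enum _); rewrite enum_valP /= dotpZr.
  rewrite mulf_eq0 => /orP[/eqP//|/eqP ui].
  by have := uJ _ (enum_valP i); rewrite ui mulr0 ltxx.
rewrite dotpZr; have := uJ j jJ; rewrite ffunE.
have [cj|cj] := ltrP (c j) 0.
  by rewrite mulN1r oppr_gt0 => uj; rewrite mulr_le0// ltW.
by rewrite mul1r => uj; rewrite mulr_ge0// ltW.
Qed.

Definition rows_span (R : realType) d n (J : {set 'I_n})
    (x : 'I_n -> 'rV[R]_d) : {vspace 'rV[R]_d} :=
  <<[tuple x (enum_val i) | i < #|J|]>>%VS.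

Lemma mem_rows_span (R : realType) d n (J : {set 'I_n})
    (x : 'I_n -> 'rV[R]_d) j : j \in J -> x j \in rows_span J x.
Proof.
move=> jJ; apply/memv_span; rewrite -(enum_rankK_in jJ jJ).
by apply/mapP; exists (enum_rank_in jJ j); rewrite ?mem_enum.
Qed.

Lemma rows_span_sub (R : realType) d n (J : {set 'I_n})
    (x : 'I_n -> 'rV[R]_d) (V : {vspace 'rV[R]_d}) :
  (forall j, j \in J -> x j \in V) -> (rows_span J x <= V)%VS.
Proof.
by move=> xV; apply/span_subvP => _ /mapP[i _ ->]; apply/xV/enum_valP.
Qed.

Lemma dim_rows_span (R : realType) d n (J : {set 'I_n})
    (x : 'I_n -> 'rV[R]_d) : interpolates J x -> \dim (rows_span J x) = #|J|.
Proof.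
move=> xJ; suff : free [tuple x (enum_val i) | i < #|J|].
  by rewrite /free size_tuple => /eqP.
apply/freeP => k k0 i; have [u uJ] := xJ (fun j => (enum_val i == j)%:R).
have := dotp0r u; rewrite -k0 dotp_sumr (bigD1 i)// -tnth_nth tnth_mktuple.
rewrite dotpZr uJ ?enum_valP// eqxx mulr1 big1 => [|j ji].
  by rewrite /= addr0.
rewrite -tnth_nth tnth_mktuple dotpZr uJ ?enum_valP//.
by rewrite (inj_eq enum_val_inj) eq_sym (negbTE ji) mulr0.
Qed.

(** * General position and sign flips *)

Definition general_position (R : realType) d n (x : 'I_n -> 'rV[R]_d) : Prop :=
  forall J : {set 'I_n}, (#|J| <= d)%N -> interpolates J x.

Definition separable (R : realType) d n (A B : {set 'I_n})
    (x : 'I_n -> 'rV[R]_d) : Prop :=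
  exists u, (forall i, i \in A -> dotp u (x i) = 0) /\
            (forall j, j \in B -> 0 < dotp u (x j)).

Definition replace (R : realType) d n (x : 'I_n -> 'rV[R]_d) j y :
    'I_n -> 'rV[R]_d :=
  fun i => if i == j then y else x i.

Definition flip (R : realType) d n j (x : 'I_n -> 'rV[R]_d) :
    'I_n -> 'rV[R]_d :=
  replace x j (- x j).

Lemma flip_id (R : realType) d n j (x : 'I_n -> 'rV[R]_d) : flip j x j = - x j.
Proof. by rewrite /flip /replace eqxx. Qed.

Lemma flip_neq (R : realType) d n j i (x : 'I_n -> 'rV[R]_d) :
  i != j -> flip j x i = x i.
Proof. by rewrite /flip /replace => /negbTE ->. Qed.

Lemma flipK (R : realType) d n j : involutive (@flip R d n j).
Proof.
move=> x; apply/funext => i; have [->|ij] := eqVneq i j.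
  by rewrite !flip_id opprK.
by rewrite !flip_neq.
Qed.

Lemma interpolates_flip (R : realType) d n (J : {set 'I_n}) j
    (x : 'I_n -> 'rV[R]_d) : interpolates J x -> interpolates J (flip j x).
Proof.
move=> xJ t; have [u uJ] := xJ (fun i => if i == j then - t i else t i).
exists u => i iJ; have [ij|ij] := eqVneq i j.
  by rewrite ij flip_id dotpNr -ij uJ// ij eqxx opprK.
by rewrite flip_neq// uJ// (negbTE ij).
Qed.

Lemma general_position_flip (R : realType) d n j (x : 'I_n -> 'rV[R]_d) :
  general_position (flip j x) <-> general_position x.
Proof.
split=> gx J Jd; last exact/interpolates_flip/gx.
by rewrite -(flipK j x); exact/interpolates_flip/gx.
Qed.

(** The reciprocal of 1 plus the sum of all ratios [|b j| / a j] is small enough for every [j] at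
    once. *)
Lemma small_multiplier (R : realType) (I : finType) (B : {set I})
    (a b : I -> R) : (forall j, j \in B -> 0 < a j) ->
  exists2 e, 0 < e & forall j, j \in B -> e * `|b j| < a j.
Proof.
move=> a_gt0; pose S := 1 + \sum_(j in B) `|b j| / a j.
have S_gt0 : 0 < S.
  by rewrite ltr_pwDl// sumr_ge0// => j jB; rewrite divr_ge0// ltW// a_gt0.
exists S^-1 => [|j jB]; first by rewrite invr_gt0.
rewrite mulrC ltr_pdivrMr// mulrC -ltr_pdivrMr ?a_gt0// /S (bigD1 j)//=.
rewrite addrCA ltrDl ltr_pwDl// sumr_ge0// => i /andP[iB _].
by rewrite divr_ge0// ltW// a_gt0.
Qed.

Lemma separable_flipP (R : realType) d n (A B : {set 'I_n}) j
    (x : 'I_n -> 'rV[R]_d) : j \notin A -> j \notin B ->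
  separable A (j |: B) (flip j x) <->
  exists u, [/\ forall i, i \in A -> dotp u (x i) = 0,
                forall i, i \in B -> 0 < dotp u (x i) & dotp u (x j) < 0].
Proof.
move=> jA jB.
have neq (C : {set 'I_n}) i : j \notin C -> i \in C -> i != j.
  by move=> jC; apply: contraTneq => ->.
split=> [[u [uA uB]]|[u [uA uB uj]]]; exists u.
  split=> [i iA|i iB|].
  - by rewrite -(uA i iA) flip_neq// (neq A).
  - by have := uB i; rewrite flip_neq ?(neq B)//; apply; rewrite !inE iB orbT.
  - by have := uB j; rewrite flip_id dotpNr oppr_gt0; apply; rewrite !inE eqxx.
split=> i.
  by move=> iA; rewrite flip_neq ?uA// (neq A).
rewrite !inE => /predU1P[->|iB]; first by rewrite flip_id dotpNr oppr_gt0.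
by rewrite flip_neq ?uB// (neq B).
Qed.

(** The factor [s] allows steps of the same size along [v] and along [- v], so that a further vector
    can be pushed to either side. *)
Lemma separable_perturb (R : realType) d n (A B : {set 'I_n})
    (x : 'I_n -> 'rV[R]_d) u v :
  (forall i, i \in A -> dotp u (x i) = 0 /\ dotp v (x i) = 0) ->
  (forall i, i \in B -> 0 < dotp u (x i)) ->
  exists2 e, 0 < e & forall s, `|s| <= 1 ->
    (forall i, i \in A -> dotp (u + (s * e) *: v) (x i) = 0) /\
    (forall i, i \in B -> 0 < dotp (u + (s * e) *: v) (x i)).
Proof.
move=> uvA uB; have [e e0 eB] := small_multiplier (fun i => dotp v (x i)) uB.
exists e => // s s1; split=> i iS; rewrite dotpDl dotpZl.
  by have [-> ->] := uvA i iS; rewrite mulr0 addr0.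
rewrite -ltrBlDl sub0r ltrNl; apply: le_lt_trans (eB i iS).
rewrite (le_trans (ler_norm _))// normrN !normrM -mulrA (gtr0_norm e0).
by rewrite ler_piMl// mulr_ge0// ltW.
Qed.

Lemma general_position_dual (R : realType) d n (A : {set 'I_n}) j
    (x : 'I_n -> 'rV[R]_d) :
  general_position x -> (#|A| < d)%N -> j \notin A ->
  exists2 v, dotp v (x j) = 1 & forall i, i \in A -> dotp v (x i) = 0.
Proof.
move=> gx Ad jA; have [|v vP] := gx (j |: A) _ (fun i => (i == j)%:R).
  by rewrite cardsU1 jA.
exists v => [|i iA]; first by rewrite vP ?setU11// eqxx.
by rewrite vP ?inE ?iA ?orbT//; case: eqP iA jA => // -> ->.
Qed.

(** According to its sign at [x j], a functional serves for [x] or for the flipped family. If it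
    vanishes there, a small multiple of a functional that is 1 at [x j] and 0 on [A] is added. *)
Lemma separable_flip_or (R : realType) d n (A B : {set 'I_n}) j
    (x : 'I_n -> 'rV[R]_d) :
  general_position x -> (#|A| < d)%N -> j \notin A -> j \notin B ->
  separable A (j |: B) x \/ separable A (j |: B) (flip j x) <->
  separable A B x.
Proof.
move=> gx Ad jA jB; rewrite separable_flipP//; split.
  case=> [[u [uA uB]]|[u [uA uB _]]]; exists u; split=> // i iB.
  by apply: uB; rewrite !inE iB orbT.
case=> u [uA uB]; have [uj|uj|uj] := ltrgtP (dotp u (x j)) 0.
- by right; exists u.
- by left; exists u; split=> // i; rewrite !inE => /predU1P[->//|/uB].
have [v vj vA] := general_position_dual gx Ad jA.
have [|e e0 eP] := separable_perturb (A := A) (v := v) _ uB.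
  by move=> i iA; rewrite uA// vA.
have [|vA' vB] := eP 1; first by rewrite normr1.
left; exists (u + (1 * e) *: v); split=> // i.
rewrite !inE => /predU1P[->|/vB//].
by rewrite dotpDl dotpZl uj vj mul1r mulr1 add0r.
Qed.

(** Two functionals of opposite sign at [x j] have a positive combination vanishing there;
    conversely, a functional vanishing at [x j] can be tilted to either side. *)
Lemma separable_flip_and (R : realType) d n (A B : {set 'I_n}) j
    (x : 'I_n -> 'rV[R]_d) :
  general_position x -> (#|A| < d)%N -> j \notin A -> j \notin B ->
  separable A (j |: B) x /\ separable A (j |: B) (flip j x) <->
  separable (j |: A) B x.
Proof.
move=> gx Ad jA jB; rewrite separable_flipP//; split.
  move=> [[u [uA uB]] [v [vA vB vj]]].
  have uj : 0 < dotp u (x j) by rewrite uB ?setU11.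
  (* The coefficients [dotp u (x j)] and [- dotp v (x j)] are positive, so positivity on [B] is
     kept, while the values at [x j] cancel. *)
  exists (dotp u (x j) *: v - dotp v (x j) *: u); split=> i.
    rewrite !inE dotpDl dotpNl !dotpZl => /predU1P[->|iA]; first by ring.
    by rewrite (uA _ iA) (vA _ iA) !mulr0 subr0.
  move=> iB; rewrite dotpDl dotpNl !dotpZl -mulNr addr_gt0 ?mulr_gt0 ?vB//.
    by rewrite oppr_gt0.
  by rewrite uB// !inE iB orbT.
case=> u [uA uB]; have [v vj vA] := general_position_dual gx Ad jA.
have uj : dotp u (x j) = 0 by rewrite uA ?setU11.
have uA' i : i \in A -> dotp u (x i) = 0 by move=> iA; rewrite uA// !inE iA orbT.
have [|e e0 eP] := separable_perturb (A := A) (v := v) _ uB.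
  by move=> i iA; rewrite uA'// vA.
split.
  have [|vA' vB] := eP 1; first by rewrite normr1.
  exists (u + (1 * e) *: v); split=> // i; rewrite !inE => /predU1P[->|/vB//].
  by rewrite dotpDl dotpZl uj vj mul1r mulr1 add0r.
have [|vA' vB] := eP (- 1); first by rewrite normrN1.
exists (u + (- 1 * e) *: v); split=> //.
by rewrite dotpDl dotpZl uj vj mulN1r mulr1 add0r oppr_lt0.
Qed.

Lemma subset_of_card (T : finType) (J : {set T}) m :
  (m <= #|J|)%N -> exists2 K : {set T}, K \subset J & #|K| = m.
Proof.
rewrite -bin_gt0 -cards_draws card_gt0 => /set0Pn[K].
by rewrite inE => /andP[KJ /eqP]; exists K.
Qed.

(** Any [d] of the vectors span the space, so a nonzero functional cannot vanish on that many. *)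
Lemma general_position_card_orthogonal (R : realType) d n (J : {set 'I_n})
    (x : 'I_n -> 'rV[R]_d) u : general_position x -> u != 0 ->
  (forall j, j \in J -> dotp u (x j) = 0) -> (#|J| < d)%N.
Proof.
move=> gx u0 uJ; rewrite ltnNge; apply/negP => /subset_of_card[K KJ Kd].
move/negP: u0; apply; apply/eqP.
apply: (interpolates_orthogonal (gx K _) Kd); first by rewrite Kd.
by move=> j jK; rewrite uJ// (fintype.subsetP KJ).
Qed.

(** Weak inequalities become strict: fewer than [d] vectors lie in the kernel of [u], so some [v]
    equals 1 on all of them, and a small multiple of [v] is added to [- u]. *)
Lemma pos_neq_setT_separable (R : realType) d n (x : 'I_n -> 'rV[R]_d) :
  (0 < n)%N -> general_position x ->
  pos x <> [set: 'rV[R]_d] <-> separable finset.set0 [set: 'I_n] x.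
Proof.
move=> n_gt0 gx; rewrite pos_neq_setT; split=> [[u u0 ux]|[u [_ ux]]].
  pose J := finset (fun i => dotp u (x i) == 0).
  have uJ j : j \in J -> dotp u (x j) = 0 by rewrite inE => /eqP.
  have /ltnW/gx/(_ (fun=> 1))[v vJ] := general_position_card_orthogonal gx u0 uJ.
  have uJC j : j \in ~: J -> 0 < dotp (- u) (x j).
    by rewrite !inE dotpNl oppr_gt0 lt_neqAle ux andbT.
  have [|e e0 eP] := separable_perturb (A := finset.set0) (v := v) _ uJC.
    by move=> i; rewrite inE.
  have [|_ eJC] := eP 1; first by rewrite normr1.
  exists (- u + (1 * e) *: v); split=> [i|i _]; first by rewrite inE.
  have [iJ|iJ] := boolP (i \in J); last by apply: eJC; rewrite inE.
  by rewrite dotpDl dotpNl dotpZl uJ// vJ// oppr0 add0r mul1r mulr1.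
exists (- u) => [|i]; last by rewrite dotpNl oppr_le0 ltW// ux ?inE.
rewrite oppr_eq0; apply/eqP => u0.
by have := ux (Ordinal n_gt0); rewrite u0 dotp0l ltxx inE => /(_ isT).
Qed.

(** * Faces of a positive hull *)

Definition pos_on (R : realType) d n (J : {set 'I_n})
    (x : 'I_n -> 'rV[R]_d) : set 'rV[R]_d :=
  [set y | exists2 c : 'I_n -> R,
     (forall i, 0 <= c i) & y = \sum_(i in J) c i *: x i].

Lemma pos_on_mem (R : realType) d n (J : {set 'I_n}) j
    (x : 'I_n -> 'rV[R]_d) : j \in J -> pos_on J x (x j).
Proof.
move=> jJ; exists (fun i => (i == j)%:R) => //.
rewrite (bigD1 j)//= eqxx scale1r big1 ?addr0// => i /andP[_ /negbTE ->].
by rewrite scale0r.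
Qed.

Lemma pos_mem (R : realType) d n (x : 'I_n -> 'rV[R]_d) j : pos x (x j).
Proof.
have [c c0 ->] := pos_on_mem x (finset.in_setT j).
by exists c => //; under eq_bigl do rewrite inE.
Qed.

(** All terms [c i * dotp u (x i)] are nonpositive, so their sum vanishes only if each does;
    generators off the hyperplane then have coefficient 0. *)
Lemma face_of_pos (R : realType) d n (x : 'I_n -> 'rV[R]_d) u :
  (forall i, dotp u (x i) <= 0) ->
  pos x `&` [set y | dotp u y = 0] =
  pos_on (finset (fun i => dotp u (x i) == 0)) x.
Proof.
move=> ux; apply/seteqP; split=> y.
  move=> [[c c0 ->] /= /eqP]; rewrite dotp_sumr => uy; exists c => //.
  rewrite [RHS]big_mkcond /=; apply: eq_bigr => i _; rewrite inE.
  case: ifPn => // ui; move: uy; rewrite -oppr_eq0 -sumrN psumr_eq0; last first.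
    by move=> j _; rewrite dotpZr -mulrN mulr_ge0// oppr_ge0.
  move=> /allP/(_ i (mem_index_enum _)); rewrite oppr_eq0 dotpZr mulf_eq0.
  by rewrite (negbTE ui) orbF => /eqP ->; rewrite scale0r.
move=> [c c0 ->]; split=> /=.
  exists (fun i => if dotp u (x i) == 0 then c i else 0).
    by move=> i; case: ifP.
  rewrite big_mkcond /=; apply: eq_bigr => i _; rewrite inE.
  by case: ifP => //; rewrite scale0r.
by rewrite dotp_sumr big1// => i; rewrite inE dotpZr => /eqP ->; rewrite mulr0.
Qed.

Lemma has_dim_pos_on (R : realType) d n (J : {set 'I_n})
    (x : 'I_n -> 'rV[R]_d) k :
  has_dim (pos_on J x) k <-> \dim (rows_span J x) = k.
Proof.
have sub y : pos_on J x y -> y \in rows_span J x.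
  by move=> [c _ ->]; apply: memv_suml => i iJ; apply/memvZ/mem_rows_span.
have min (V : {vspace 'rV[R]_d}) :
    (forall y, pos_on J x y -> y \in V) -> (rows_span J x <= V)%VS.
  by move=> xV; apply: rows_span_sub => j jJ; apply/xV/pos_on_mem.
split=> [[U [xU Umin <-]]|<-]; last by exists (rows_span J x).
by congr (\dim _); apply/eqP; rewrite eqEsubv min// Umin.
Qed.

(** More than [d] indices would include [d] independent vectors, which already span dimension
    [d]. *)
Lemma dim_rows_span_lt (R : realType) d n (J : {set 'I_n})
    (x : 'I_n -> 'rV[R]_d) : general_position x ->
  (\dim (rows_span J x) < d)%N -> \dim (rows_span J x) = #|J|.
Proof.
move=> gx Jd; have [/gx/dim_rows_span//|/ltnW] := leqP #|J| d.
move=> /subset_of_card[K KJ Kd].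
have /dim_rows_span : interpolates K x by apply: gx; rewrite Kd.
rewrite Kd => dK; have : (\dim (rows_span K x) <= \dim (rows_span J x))%N.
  apply/dimvS/rows_span_sub => j jK.
  by rewrite mem_rows_span// (fintype.subsetP KJ).
by rewrite dK leqNgt Jd.
Qed.

(** A face is generated by the [x i] on its supporting hyperplane. As its dimension [k] is below
    [d], these generators are independent and number exactly [k]. *)
Lemma faces_of_pos (R : realType) d n (x : 'I_n -> 'rV[R]_d) k :
  general_position x -> (k < d)%N ->
  [set F | is_face (pos x) F /\ has_dim F k] =
  (fun J => pos_on J x) @`
    [set J : {set 'I_n} | #|J| = k /\ separable J (~: J) x].
Proof.
move=> gx kd; apply/seteqP; split=> F /=.
  move=> [[u [ux ->]]]; have {}ux i : dotp u (x i) <= 0 by apply/ux/pos_mem.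
  rewrite face_of_pos// has_dim_pos_on => uk.
  exists (finset (fun i => dotp u (x i) == 0)) => //; split.
    by rewrite -(dim_rows_span_lt gx) uk.
  exists (- u); split=> i; rewrite !inE dotpNl; first by move/eqP->; rewrite oppr0.
  by rewrite oppr_gt0 lt_neqAle ux andbT.
move=> [J [Jk [u [uJ uJC]]] <-]; split; last first.
  by rewrite has_dim_pos_on dim_rows_span//; apply: gx; rewrite Jk ltnW.
have uE i : (dotp (- u) (x i) == 0) = (i \in J).
  rewrite dotpNl oppr_eq0; have [/uJ ->|iJ] := boolP (i \in J).
    by rewrite eqxx.
  by rewrite gt_eqF// uJC// inE.
have ux i : dotp (- u) (x i) <= 0.
  rewrite dotpNl oppr_le0; have [/uJ ->//|iJ] := boolP (i \in J).
  by rewrite ltW// uJC// inE.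
exists (- u); split.
  move=> _ [c c0 ->]; rewrite dotp_sumr sumr_le0// => i _.
  by rewrite dotpZr mulr_ge0_le0.
rewrite face_of_pos//; congr (pos_on _ x).
by apply/setP => i; rewrite inE uE.
Qed.

(** The functional vanishes on the cone over [J] and is positive at every other generator, so [J] is
    recovered as the set of [j] with [x j] in the cone. *)
Lemma pos_on_inj (R : realType) d n (x : 'I_n -> 'rV[R]_d) :
  {in [pred J : {set 'I_n} | `[< separable J (~: J) x >]] &,
    injective (fun J => pos_on J x)}.
Proof.
have sub (J K : {set 'I_n}) : separable J (~: J) x ->
    pos_on J x = pos_on K x -> K \subset J.
  move=> [u [uJ uJC]] JK; apply/fintype.subsetP => j /(pos_on_mem x).
  rewrite -JK => -[c _ xj]; apply: contraT => jJ.
  have := uJC j; rewrite inE => /(_ jJ).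
  by rewrite xj dotp_sumr big1 ?ltxx// => i iJ; rewrite dotpZr uJ// mulr0.
move=> J K xJ xK JK.
have sJ : separable J (~: J) x by exact: (elimT (asboolP _) xJ).
have sK : separable K (~: K) x by exact: (elimT (asboolP _) xK).
by apply/eqP; rewrite finset.eqEsubset (sub _ _ sJ)// (sub _ _ sK).
Qed.

Lemma face_number_pos (R : realType) d n (x : 'I_n -> 'rV[R]_d) k :
  general_position x -> (k < d)%N ->
  face_number k (pos x) =
  (\sum_(J : {set 'I_n} | #|J| == k) `[< separable J (~: J) x >])%N.
Proof.
move=> gx kd; rewrite /face_number faces_of_pos//.
set A := [set J | _].
pose S := finset (fun J : {set 'I_n} => (#|J| == k) && `[< separable J (~: J) x >]).
have AS : A = [set` S].
  apply/seteqP; split=> J /=; rewrite inE.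
    by move=> [-> /asboolP ->]; rewrite eqxx.
  by move=> /andP[/eqP ? /asboolP ?].
have finA : finite_set A by exact: finite_finset.
rewrite fset_set_image// card_in_imfset /=; last first.
  move=> J K; rewrite !in_fset_set// !inE => -[_ sJ] [_ sK].
  by apply: pos_on_inj; apply/asboolP.
transitivity #|S|.
  rewrite cardE; apply/perm_size/uniq_perm; rewrite ?enum_uniq ?fset_uniq// => J.
  by rewrite mem_enum in_fset_set// AS; apply/idP/idP => [/set_mem|/mem_set].
rewrite -sum1dep_card big_mkcondr /=; apply: eq_bigr => J _.
by case: asboolP.
Qed.

(** * Measurability *)

(** Boxes form an intersection-stable generator of the product sigma-algebra, so a law on [config]
    is determined by its values on them. *)
Definition rectangles (R : realType) d n : set (set ('I_n -> 'rV[R]_d)) :=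
  [set S | exists2 B : 'I_n -> set (borel_rV R d),
     (forall i, measurable (B i)) & S = [set x | forall i, B i (x i)]].

Definition config (R : realType) d n := g_sigma_algebraType (@rectangles R d n).

Lemma measurable_config (R : realType) d n dsp (T : measurableType dsp)
    (f : T -> config R d n) :
  (forall i, measurable_fun setT (fun w => f w i : borel_rV R d)) ->
  measurable_fun setT f.
Proof.
move=> mf.
refine (@measurability _ _ _ (config R d n) _ _ (@rectangles R d n) erefl _).
move=> _ [_ [B mB ->] <-]; rewrite setTI.
rewrite (_ : _ @^-1` _ = \bigcap_i ((fun w => f w i) @^-1` B i)).
  apply: fin_bigcap_measurable => // i _.
  by rewrite -[X in measurable X]setTI; exact: mf.
by apply/seteqP; split=> w /= fB i; [move=> _; exact: fB|exact: fB].
Qed.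

Lemma measurable_coord (R : realType) d n (i : 'I_n) :
  measurable_fun setT (fun x : config R d n => x i : borel_rV R d).
Proof.
move=> _ B mB; rewrite setTI; apply: sub_sigma_algebra.
exists (fun j => if j == i then B else setT) => [j|]; first by case: ifP.
apply/seteqP; split=> x /= xB; last by have := xB i; rewrite eqxx.
by move=> j; case: eqVneq => // ->.
Qed.

Lemma continuous_borel_measurable (R : realType) d (f : 'rV[R]_d -> R) :
  continuous f -> measurable_fun setT (f : borel_rV R d -> R).
Proof.
move=> /continuousP cf; apply: (measurability _ (RGenOpens.measurableE R)).
move=> _ [_ [a [b ->] <-]]; rewrite setTI; apply: sub_sigma_algebra.
exact/cf/interval_open.
Qed.

Lemma measurable_entry (R : realType) d (k : 'I_d) :
  measurable_fun setT (fun x : borel_rV R d => (x : 'rV[R]_d) 0 k).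
Proof.
apply: (@continuous_borel_measurable R d (fun x => x 0 k)).
exact: coord_continuous.
Qed.

Lemma measurable_dotp (R : realType) d (u : 'rV[R]_d) :
  measurable_fun setT (dotp u : borel_rV R d -> R).
Proof.
apply: measurable_sum => k; apply: measurable_funM => //.
exact: measurable_entry.
Qed.

Lemma measurable_opp_borel (R : realType) d :
  measurable_fun setT (fun x : borel_rV R d => - (x : 'rV[R]_d) : borel_rV R d).
Proof.
refine (@measurability _ _ _ (borel_rV R d) _ _ (@open 'rV[R]_d) erefl _).
move=> _ [U oU <-]; rewrite setTI; apply: sub_sigma_algebra.
by apply: open_comp => // x _; exact: opp_continuous.
Qed.

Lemma measurable_set_lt (R : realType) dsp (T : measurableType dsp)
    (f g : T -> R) : measurable_fun setT f -> measurable_fun setT g ->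
  measurable [set x | f x < g x].
Proof.
move=> mf mg; have := measurable_fun_ltr mf mg; move=> /(_ measurableT [set true]).
rewrite setTI (_ : _ @^-1` _ = [set x | f x < g x])//; first exact.
Qed.

Lemma exists_rat_between (R : realType) (I : finType) (a b : I -> R) :
  (forall i, a i < b i) ->
  exists r : {ffun I -> rat}, forall i, a i < ratr (r i) < b i.
Proof.
move=> ab; have [r rP] := choice (fun i => rat_in_itvoo (ab i)).
by exists [ffun i => r i] => i; rewrite ffunE; have := rP i; rewrite in_itv.
Qed.

Lemma dotp_norm_le (R : realType) d (u x : 'rV[R]_d) e :
  (forall k, `|u 0 k| <= e) -> `|dotp u x| <= e * \sum_k `|x 0 k|.
Proof.
move=> ue; rewrite (le_trans (ler_norm_sum _ _ _))// mulr_sumr ler_sum// => k _.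
by rewrite normrM ler_wpM2r.
Qed.

(** The inequalities are open in [u], so rational [u] suffice and the existential becomes a
    countable union. *)
Lemma measurable_signed_halfspaces (R : realType) d n (J : {set 'I_n})
    (s : 'I_n -> R) :
  measurable [set x : config R d n |
    exists u, forall j, j \in J -> 0 < s j * dotp u (x j)].
Proof.
pose q (r : {ffun 'I_d -> rat}) : 'rV[R]_d := \row_k ratr (r k).
rewrite (_ : [set x | _] = \bigcup_(r : {ffun 'I_d -> rat})
    \bigcap_(j in [set` J]) [set x | 0 < s j * dotp (q r) (x j)]).
  apply: countable_bigcupT_measurable => // r.
  apply: fin_bigcap_measurable => // j _; apply: measurable_set_lt => //.
  apply: measurable_funM => //.
  apply: (measurableT_comp (f := dotp (q r) : borel_rV R d -> R)).
    exact: measurable_dotp.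
  exact: measurable_coord.
apply/seteqP; split=> x /=; last by move=> [r _ rP]; exists (q r).
move=> [u uP].
(* Moving each coordinate of [u] by at most [e] changes [s j * dotp u (x j)] by at most [e] times
   this bound, hence by less than its value. *)
have [e e0 eP] :=
  small_multiplier (fun j => `|s j| * \sum_k `|(x j : 'rV[R]_d) 0 k|) uP.
have [|r rP] := @exists_rat_between R 'I_d (fun k => u 0 k - e) (fun k => u 0 k + e).
  by move=> k; lra.
exists r => // j jJ /=; rewrite -[q r](subrK u) dotpDl mulrDr.
rewrite -ltrBlDr sub0r ltrNl; apply: le_lt_trans (eP j jJ).
have S0 : 0 <= `|s j| * \sum_k `|(x j : 'rV[R]_d) 0 k|.
  by rewrite mulr_ge0// sumr_ge0.
rewrite (le_trans (ler_norm _))// normrN normrM (ger0_norm S0).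
rewrite mulrCA ler_wpM2l// dotp_norm_le// => k.
by rewrite !mxE ler_norml; have := rP k; lra.
Qed.

Lemma measurable_interpolates (R : realType) d n (J : {set 'I_n}) :
  measurable [set x : config R d n | interpolates J x].
Proof.
rewrite (_ : [set x | _] = \bigcap_(s : {ffun 'I_n -> bool})
    [set x | exists u : 'rV[R]_d,
       forall j, j \in J -> 0 < (-1) ^+ s j * dotp u (x j)]).
  by apply: fin_bigcap_measurable => // s _; exact: measurable_signed_halfspaces.
by apply/seteqP; split=> x /=; rewrite interpolates_sign => xs s; [move=> _|];
  exact: xs.
Qed.

Lemma measurable_general_position (R : realType) d n :
  measurable [set x : config R d n | general_position x].
Proof.
rewrite (_ : [set x | _] = \bigcap_(J in [set J : {set 'I_n} | (#|J| <= d)%N])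
    [set x | interpolates J x]); last by apply/seteqP; split.
by apply: fin_bigcap_measurable => // J _; exact: measurable_interpolates.
Qed.

Lemma measurable_flip (R : realType) d n (j : 'I_n) :
  measurable_fun setT (flip j : config R d n -> config R d n).
Proof.
apply: measurable_config => i; have [->|ij] := eqVneq i j.
  have -> : (fun w : config R d n => flip j w j) = (fun w => - w j).
    by apply/funext => w; rewrite flip_id.
  apply: (measurableT_comp
    (f := fun y : borel_rV R d => - (y : 'rV[R]_d) : borel_rV R d)).
    exact: measurable_opp_borel.
  exact: measurable_coord.
have -> : (fun w : config R d n => flip j w i) = (fun w => w i).
  by apply/funext => w; rewrite flip_neq.
exact: measurable_coord.
Qed.

(** Describes the event by countably many conditions: rational nonnegative combinations come within
    distance 1, in the sum norm, of every signed basis vector. *)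
Lemma pos_eq_setT_rat (R : realType) d n (x : 'I_n -> 'rV[R]_d) :
  pos x = [set: 'rV[R]_d] <->
  forall (b : bool) (k : 'I_d), exists2 r : {ffun 'I_n -> rat},
    [forall i, 0 <= r i] &
    \sum_j `|\sum_i ratr (r i) * x i 0 j - (-1) ^+ b * (j == k)%:R| < 1.
Proof.
split=> [xT b k|xr].
  have : pos x ((-1) ^+ b *: delta_mx 0 k) by rewrite xT.
  move=> [c c0 cE]; pose S := \sum_j \sum_i `|x i 0 j|.
  have S0 : 0 <= S by apply: sumr_ge0 => j _; exact: sumr_ge0.
  have S1 : 0 < 1 + S by rewrite ltr_pwDl.
  (* Rounding each coefficient up by less than [e] costs at most [e * S], which is below
     [e * (1 + S) = 1]. *)
  pose e := (1 + S)^-1; have e0 : 0 < e by rewrite invr_gt0.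
  have [|r rP] := @exists_rat_between R 'I_n c (fun i => c i + e).
    by move=> i; rewrite ltrDl.
  exists r.
    apply/forallP => i; rewrite -(ler_rat R) rmorph0 (le_trans (c0 i))//.
    by have /andP[/ltW] := rP i.
  have eS : e * (1 + S) = 1 by rewrite mulVf// gt_eqF.
  rewrite (@le_lt_trans _ _ (e * S)) -?[ltRHS]eS ?ltr_pM2l ?ltrDr//.
  rewrite mulr_sumr ler_sum// => j _; rewrite mulr_sumr.
  have -> : (-1) ^+ b * (j == k)%:R = \sum_i c i * x i 0 j.
    have /(congr1 (fun y : 'rV[R]_d => y 0 j)) := cE.
    rewrite !mxE summxE eqxx /= => ->; apply: eq_bigr => i _; by rewrite mxE.
  rewrite -sumrB (le_trans (ler_norm_sum _ _ _))// ler_sum// => i _.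
  rewrite -mulrBl normrM ler_wpM2r// ler_norml.
  by have := rP i; lra.
apply: contrapT => /pos_neq_setT[u u0 ux].
have [j0 uj0] : exists j, u 0 j != 0.
  apply/existsP; apply: contraR u0 => /existsPn u0.
  by apply/eqP/rowP => j; rewrite mxE; have /negPn/eqP := u0 j.
have [k _ kmax] :=
  @Order.TotalTheory.arg_maxP _ R 'I_d j0 predT (fun j => `|u 0 j|) isT.
have uk : 0 < `|u 0 k| by rewrite (lt_le_trans _ (kmax j0 isT))// normr_gt0.
have [r /forallP r0 rP] := xr (u 0 k < 0) k.
pose q : 'rV[R]_d := (-1) ^+ (u 0 k < 0)%R *: delta_mx 0 k.
pose y := \sum_i ratr (r i) *: x i.
have uy : dotp u y <= 0.
  rewrite dotp_sumr sumr_le0// => i _; rewrite dotpZr mulr_ge0_le0//.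
  by rewrite ler0q.
have uq : dotp u q = `|u 0 k|.
  rewrite dotpZr dotp_delta; have [ul|ul] := boolP (u 0 k < 0).
    by rewrite mulN1r ltr0_norm.
  by rewrite mul1r ger0_norm// leNgt.
(* As [|u 0 k|] is maximal, [dotp u (y - q)] is below [|u 0 k|] in absolute value; but
   [dotp u q = |u 0 k|] and [dotp u y <= 0] make it at least that. *)
have := @dotp_norm_le R d u (y - q) `|u 0 k| (fun j => kmax j isT).
apply/negP; rewrite -ltNge (@lt_le_trans _ _ `|u 0 k|)//.
  rewrite gtr_pMr// (le_lt_trans _ rP)// ler_sum// => j _.
  rewrite !mxE summxE eqxx /= le_eqVlt; apply/orP; left; apply/eqP.
  by congr (`|_ - _|); apply: eq_bigr => i _; rewrite mxE.
rewrite -(normrN (dotp _ _)) (le_trans _ (ler_norm _))//.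
rewrite dotpDr dotpNr uq opprB lerBrDr.
by rewrite gerDl.
Qed.

Lemma measurable_pos_neq_setT (R : realType) d n :
  measurable [set x : config R d n | pos x <> [set: 'rV[R]_d]].
Proof.
rewrite -[X in measurable X]setCK; apply: measurableC.
rewrite [X in measurable X](_ : _ = \bigcap_(b : bool) \bigcap_(k : 'I_d)
    \bigcup_(r : {ffun 'I_n -> rat})
    ([set x : config R d n | [forall i, 0 <= r i]] `&`
     [set x : config R d n | \sum_j `|\sum_i ratr (r i) * (x i : 'rV[R]_d) 0 j -
        (-1) ^+ b * (j == k)%:R| < 1])).
  apply: fin_bigcap_measurable => // b _; apply: fin_bigcap_measurable => // k _.
  apply: countable_bigcupT_measurable => // r; apply: measurableI.
    by case: [forall i, _]; [rewrite set_true|rewrite set_false].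
  apply: measurable_set_lt => //; apply: measurable_sum => j.
  apply: measurableT_comp => //; apply: measurable_funB => //.
  apply: measurable_sum => i; apply: measurable_funM => //.
  apply: (measurableT_comp (f := fun y : borel_rV R d => (y : 'rV[R]_d) 0 j)).
    exact: measurable_entry.
  exact: measurable_coord.
apply/seteqP; split=> x /=.
  by move=> /contrapT/pos_eq_setT_rat xr b _ k _; have [r] := xr b k; exists r.
move=> xr; apply/not_implyP; split; last exact.
apply/pos_eq_setT_rat => b k.
by have [r _ []] := xr b Logic.I k Logic.I; exists r.
Qed.

(** * Random configurations with a product law *)

Definition product_law (R : realType) d n (mu : probability (config R d n) R)
    (phi : probability (borel_rV R d) R) : Prop :=
  forall B : 'I_n -> set (borel_rV R d), (forall i, measurable (B i)) ->
    mu [set x | forall i, B i (x i)] = (\prod_i phi (B i))%E.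

Lemma measurable_replace (R : realType) d n (j : 'I_n) :
  measurable_fun setT (fun z : config R d n * borel_rV R d =>
    replace z.1 j z.2 : config R d n).
Proof.
apply: measurable_config => i; have [->|ij] := eqVneq i j.
  have -> : (fun z : config R d n * borel_rV R d => replace z.1 j z.2 j) = snd.
    by apply/funext => z; rewrite /replace eqxx.
  exact: measurable_snd.
have -> : (fun z : config R d n * borel_rV R d => replace z.1 j z.2 i) =
    (fun x : config R d n => x i : borel_rV R d) \o fst.
  by apply/funext => z; rewrite /replace (negbTE ij).
apply: measurableT_comp; [exact: measurable_coord|exact: measurable_fst].
Qed.

Lemma measurable_replace1 (R : realType) d n (j : 'I_n) (x : config R d n) :
  measurable_fun setT (fun y : borel_rV R d => replace x j y : config R d n).
Proof.
apply: measurable_config => i; have [->|ij] := eqVneq i j.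
  have -> : (fun y : borel_rV R d => replace x j y j) = id.
    by apply/funext => y; rewrite /replace eqxx.
  exact: measurable_id.
have -> : (fun y : borel_rV R d => replace x j y i) = cst (x i).
  by apply/funext => y; rewrite /replace (negbTE ij).
exact: measurable_cst.
Qed.

(** Replacing coordinate [j] by an independent draw from [phi] preserves the law, since the two
    measures agree on boxes. *)
Lemma resampling (R : realType) d n (mu : probability (config R d n) R)
    (phi : probability (borel_rV R d) R) (j : 'I_n) (S : set (config R d n)) :
  product_law mu phi -> measurable S ->
  mu S = (\int[mu]_x phi [set y | S (replace x j y)])%E.
Proof.
move=> mu_phi mS.
pose g (z : (config R d n * borel_rV R d)%type) : config R d n := replace z.1 j z.2.
pose mg := isMeasurableFun.Build _ _ _ _ g (measurable_replace j).
pose G : {mfun (config R d n * borel_rV R d)%type >-> config R d n} := HB.pack g mg.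
transitivity (distribution (mu \x phi)%E G S); last first.
  apply: eq_integral => x _ /=; congr (phi _).
  by apply/seteqP; split=> y; rewrite /xsection /= inE.
apply: (@measure_unique _ R (config R d n) (@rectangles R d n) (fun=> setT) erefl
  _ _ _ mu (distribution (mu \x phi)%E G) _ _ S mS).
- move=> _ _ [B mB ->] [C mC ->]; exists (fun i => B i `&` C i).
    by move=> i; exact: measurableI.
  apply/seteqP; split=> x /=; first by move=> [xB xC] i; split.
  by move=> xBC; split=> i; have [] := xBC i.
- by move=> _; exists (fun=> setT) => //; apply/seteqP; split.
- by apply/seteqP; split=> // x _; exists 0%N.
- move=> _ [B mB ->].
  (* The discarded coordinate [j] becomes unconstrained and contributes the factor 1; the fresh draw
     contributes [phi (B j)]. *)
  pose B' i := if i == j then setT else B i.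
  have mB' i : measurable (B' i) by rewrite /B'; case: ifP.
  transitivity (\prod_i phi (B i))%E; first exact: mu_phi.
  rewrite /distribution /pushforward.
  have GE : G @^-1` [set x | forall i, B i (x i)] =
      [set x | forall i, B' i (x i)] `*` B j.
    apply/seteqP; split=> -[x y] /=.
      move=> xB; split=> [i|]; last first.
        by have := xB j; rewrite /= /g /replace /= eqxx.
      rewrite /B'; have [//|ij] := eqVneq i j.
      by have := xB i; rewrite /= /g /replace /= (negbTE ij).
    move=> [xB yB] i; rewrite /= /g /replace /=.
    have [->//|ij] := eqVneq i j.
    by have := xB i; rewrite /B' (negbTE ij).
  transitivity ((mu \x phi)%E ([set x | forall i, B' i (x i)] `*` B j)); last first.
    by rewrite -GE.
  rewrite product_measure1E//; last first.
    by apply: sub_sigma_algebra; exists B'.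
  transitivity ((\prod_i phi (B' i)) * phi (B j))%E; last first.
    by congr (_ * _)%E; apply/esym/mu_phi.
  have phi1 : phi (B' j) = 1%E by rewrite /B' eqxx; exact: probability_setT.
  rewrite (bigD1 j)//= [in RHS](bigD1 j)//= phi1 mul1e muleC; congr (_ * _)%E.
  by apply: eq_bigr => i ij; rewrite /B' (negbTE ij).
- by move=> _; exact: (le_lt_trans (probability_le1 mu measurableT) (ltry 1)).
Qed.

(** Once coordinate [j] is resampled, the flip only reflects the new vector, and [phi] is even. *)
Lemma flip_invariance (R : realType) d n (mu : probability (config R d n) R)
    (phi : probability (borel_rV R d) R) (j : 'I_n) (S : set (config R d n)) :
  product_law mu phi -> even_measure phi -> measurable S ->
  mu [set x | S (flip j x)] = mu S.
Proof.
move=> mu_phi phi_even mS.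
have mfS : measurable [set x : config R d n | S (flip j x)].
  by have := measurable_flip j measurableT mS; rewrite setTI.
rewrite (resampling j mu_phi mfS) (resampling j mu_phi mS).
apply: eq_integral => x _; rewrite [RHS]phi_even; last first.
  by have := measurable_replace1 j x measurableT mS; rewrite setTI.
congr (phi _).
have repE y : flip j (replace x j y) = replace x j (- y).
  apply/funext => i; rewrite /flip /replace eqxx.
  by case: eqP.
apply/seteqP; split=> y /=; rewrite repE.
  by move=> Sy; exists (- y); rewrite /= ?opprK.
by move=> [z Sz <-]; rewrite opprK.
Qed.

Lemma interpolates_setU1 (R : realType) d n (J : {set 'I_n}) j
    (x : 'I_n -> 'rV[R]_d) u : j \notin J -> interpolates J x ->
  (forall i, i \in J -> dotp u (x i) = 0) -> dotp u (x j) != 0 ->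
  interpolates (j |: J) x.
Proof.
move=> jJ xJ uJ uj t; have [v vJ] := xJ t.
exists (v + ((t j - dotp v (x j)) / dotp u (x j)) *: u) => i.
rewrite !inE dotpDl dotpZl => /predU1P[->|iJ]; first by rewrite divfK// subrKC.
by rewrite (uJ _ iJ) (vJ _ iJ) mulr0 addr0.
Qed.

(** Induction on the size of [J]: when the other vectors of [J] are independent, a dependence forces
    the resampled [x j] into a hyperplane containing them, which is null. *)
Lemma ae_interpolates (R : realType) d n (mu : probability (config R d n) R)
    (phi : probability (borel_rV R d) R) (J : {set 'I_n}) :
  product_law mu phi -> null_on_hyperplanes phi -> (#|J| <= d)%N ->
  {ae mu, forall x, interpolates J x}.
Proof.
move=> mu_phi phi0; have [m] := ubnP #|J|; elim: m J => // m IHm J Jm Jd.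
have [->|[j jJ]] := set_0Vmem J.
  by apply: aeW => x t; exists 0 => j; rewrite inE.
have JE := finset.setD1K jJ; set K := J :\ j in JE.
have jK : j \notin K by rewrite !inE eqxx.
have KJ : (#|K| < #|J|)%N by rewrite (cardsD1 j J) jJ.
have aeK : {ae mu, forall x, interpolates K x}.
  by apply: IHm; [exact: leq_trans KJ _|exact: leq_trans (ltnW KJ) Jd].
pose bad : set (config R d n) :=
  [set x | interpolates K x] `&` ~` [set x | interpolates J x].
have mbad : measurable bad.
  apply: measurableI; first exact: measurable_interpolates.
  by apply: measurableC; exact: measurable_interpolates.
have bad0 : mu bad = 0%E.
  rewrite (resampling j mu_phi mbad) integral0_eq// => x _.
  have [u u0 uK] := exists_orthogonal x (leq_trans KJ Jd).
  apply: (@subset_measure0 _ (borel_rV R d) _ phi _ (normal_hyperplane u));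
    last exact: phi0.
  - by have := measurable_replace1 j x measurableT mbad; rewrite setTI.
  - have := measurable_dotp u measurableT (measurable_set1 0).
    by rewrite setTI.
  - move=> y [yK yJ]; apply/eqP; apply: contrapT => /negP uy; apply: yJ => /=.
    rewrite -JE; apply: (@interpolates_setU1 _ _ _ _ _ _ u) => //.
      move=> i iK; rewrite /replace; case: eqP => [ij|_]; last exact: uK.
      by move: jK; rewrite -ij iK.
    by rewrite /replace eqxx.
have aebad : {ae mu, forall x, ~ bad x}.
  exists bad; split=> //.
  by move=> x /= /contrapT.
apply: (@filterS2 _ _ (ae_filter_ringOfSetsType mu) _ _ _ _ aeK aebad).
by move=> x xK xbad; apply: contrapT => xJ; apply: xbad.
Qed.

Lemma probability_general_position (R : realType) d n
    (mu : probability (config R d n) R) (phi : probability (borel_rV R d) R) :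
  product_law mu phi -> null_on_hyperplanes phi ->
  mu [set x | general_position x] = 1%E.
Proof.
move=> mu_phi phi0.
have : {ae mu, forall x, general_position x}.
  apply: (@filter_forall _ _
    (fun (J : {set 'I_n}) x => (#|J| <= d)%N -> interpolates J x) _
    (ae_filter_ringOfSetsType mu)) => J.
  have [Jd|Jd] := leqP #|J| d; last by apply: aeW.
  apply: (@filterS _ _ (ae_filter_ringOfSetsType mu) [set x | interpolates J x]).
    by move=> x /= xJ _.
  exact: (ae_interpolates mu_phi phi0 Jd).
move=> aeg; have mg := measurableC (@measurable_general_position R d n).
rewrite -(setCK [set x | _]) probability_setC//.
by rewrite (_ : mu _ = 0%E) ?sube0//; apply: measure_negligible.
Qed.

(** * Wendel probabilities *)

(* The probability that [n] symmetric random vectors in general position in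
   R^m lie in a common open half-space. *)
Fixpoint wendel (R : realType) (n m : nat) : R :=
  match n, m with
  | 0, _ => 1
  | n'.+1, 0 => 0
  | n'.+1, m'.+1 => (wendel R n' m + wendel R n' m') / 2
  end.

Lemma wendelSS (R : realType) n m :
  wendel R n.+1 m.+1 = (wendel R n m.+1 + wendel R n m) / 2.
Proof. by []. Qed.

(** Wendel's closed formula; Pascal's rule for the binomial sums matches the recursion. *)
Lemma wendelE (R : realType) n m :
  2 ^+ n * wendel R n.+1 m = (\sum_(i < m) 'C(n, i))%N%:R.
Proof.
elim: n m => [|n IHn] [|m].
- by rewrite big_ord0 mulr0.
- rewrite mul1r /= big_ord_recl bin0 big1 => [|i _]; last by rewrite bin_small.
  by rewrite addn0 divff.
- by rewrite big_ord0 mulr0.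
have half (p x y : R) : 2 * p * ((x + y) / 2) = p * x + p * y by field.
rewrite wendelSS exprS half !IHn -natrD; congr (_%:R).
rewrite !big_ord_recl !bin0 -addnA; congr addn.
by rewrite -big_split; apply: eq_bigr => i _; rewrite binS.
Qed.

Lemma wendel_gt0 (R : realType) n m : 0 < wendel R n m.+1.
Proof.
elim: n m => [//|n IHn] m; rewrite wendelSS divr_gt0//.
rewrite ltr_pwDl//; case: m => [|m]; last exact: ltW.
by case: n {IHn} => [|n]; rewrite ?ler01.
Qed.

(** With [S] the binomial sum and [C] the next binomial, the probabilities are [S / 2 ^ n] and
    [(2 S + C) / 2 ^ n.+1], so only [S / C] matters. *)
Lemma wendel_ratio (R : realType) n a : (a.+1 <= n)%N ->
  wendel R n.+1 a.+1 / wendel R n.+2 a.+2 =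
  (1 + ((\sum_(i < a.+1) 'C(n, i))%N%:R / 'C(n, a.+1)%:R : R)^-1 / 2)^-1.
Proof.
move=> an; have C0 : 0 < 'C(n, a.+1)%:R :> R by rewrite ltr0n bin_gt0.
set S := (\sum_(i < a.+1) _)%N.
have p0 : 0 < 2 ^+ n :> R by rewrite exprn_gt0.
have wE m : wendel R n.+1 m = (\sum_(i < m) 'C(n, i))%N%:R / 2 ^+ n.
  by rewrite -wendelE mulrC mulKf// gt_eqF.
have S0 : 0 < S%:R :> R.
  have := wendel_gt0 R n.+1 a; rewrite wE -/S.
  by rewrite pmulr_lgt0// invr_gt0.
have SS : (\sum_(i < a.+2) 'C(n, i))%N = (S + 'C(n, a.+1))%N by rewrite big_ord_recr.
rewrite [wendel R n.+2 _]wendelSS !wE -/S SS natrD.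
by field; rewrite !gt_eqF// ?addr_gt0// ?mulr_gt0.
Qed.

(** Keeps the [L] summands of largest index, which are the ones comparable with the next
    binomial. *)
Lemma sum_bin_ge n a L : (L <= a)%N ->
  (\sum_(j < L) 'C(n, a - j.+1) <= \sum_(i < a) 'C(n, i))%N.
Proof.
move=> La; rewrite [leqRHS](reindex_inj rev_ord_inj) /=.
rewrite (big_ord_widen _ (fun j => 'C(n, a - j.+1)) La) big_mkcond /=.
by apply: leq_sum => i _; case: ifP.
Qed.

(** * Limits of Wendel ratios when [d / N d] tends to one half *)

Section Asymptotics.
Variables (R : realType) (N : nat -> nat).
Hypothesis N_ge : forall d, (1 <= d)%N -> (d + 1 <= N d)%N.
Hypothesis N_lim : (d%:R / (N d)%:R : R) @[d --> \oo] --> (2^-1 : R).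

Lemma cvg_invn : (d%:R^-1 : R) @[d --> \oo] --> (0 : R).
Proof.
apply/(gtr0_cvgV0 (f := fun d => d%:R : R)); last exact: cvgr_idn.
by exists 1%N => // d; rewrite /= ltr0n.
Qed.

Lemma cvg_invN : ((N d)%:R^-1 : R) @[d --> \oo] --> (0 : R).
Proof.
rewrite -(mulr0 2^-1); apply: cvg_trans (cvgM N_lim cvg_invn).
apply: near_eq_cvg; exists 1%N => // d /= d0.
rewrite mulrAC divff ?mul1r// pnatr_eq0 -lt0n//.
Qed.

(** After division by [N d], numerator and denominator both tend to one half; the fixed shifts
    vanish in the limit. *)
Lemma cvg_shifted_ratio i j :
  ((d - i)%N%:R / (N d - d + j)%N%:R : R) @[d --> \oo] --> (1 : R).
Proof.
have lim : ((d%:R / (N d)%:R - i%:R * (N d)%:R^-1) *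
   (1 - d%:R / (N d)%:R + j%:R * (N d)%:R^-1)^-1 : R) @[d --> \oo] --> (1 : R).
  have l1 : (2^-1 - i%:R * 0) * (1 - 2^-1 + j%:R * 0)^-1 = 1 :> R by field.
  have Nc (c : nat) : (c%:R * (N d)%:R^-1 : R) @[d --> \oo] --> (c%:R * 0 : R).
    by apply: cvgMl_tmp; exact: cvg_invN.
  have h0 : 1 - 2^-1 + j%:R * 0 != 0 :> R by rewrite mulr0 addr0; apply/eqP; lra.
  have h1 : (d%:R / (N d)%:R - i%:R * (N d)%:R^-1 : R) @[d --> \oo] -->
      (2^-1 - i%:R * 0 : R) by exact: cvgB N_lim (Nc i).
  have h2 : (1 - d%:R / (N d)%:R : R) @[d --> \oo] --> (1 - 2^-1 : R).
    by apply: cvgB N_lim; exact: cvg_cst.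
  have h3 : (1 - d%:R / (N d)%:R + j%:R * (N d)%:R^-1 : R) @[d --> \oo] -->
      (1 - 2^-1 + j%:R * 0 : R) by exact: cvgD h2 (Nc j).
  by rewrite -[X in _ --> X]l1; apply: cvgM h1 _; exact: cvgV h0 h3.
apply: cvg_trans lim; apply: near_eq_cvg; exists (i + 1)%N => // d /= di.
have d1 : (1 <= d)%N by apply: leq_trans di; rewrite addn1.
have := N_ge d1; rewrite addn1 => dN.
have N0 : (N d)%:R != 0 :> R by rewrite pnatr_eq0 -lt0n (leq_trans _ dN).
rewrite natrD !natrB ?(ltnW dN)//; last by rewrite (leq_trans _ di)// leq_addr.
have D0 : (N d)%:R - d%:R + j%:R != 0 :> R.
  by rewrite gt_eqF// ltr_pwDl// subr_gt0 ltr_nat.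
by field; rewrite N0 D0.
Qed.

(** Neighbouring binomials ['C(n, a)] and ['C(n, a.+1)] have quotient [a.+1 / (n - a)], which tends
    to 1 near the middle; a fixed number [j] of such quotients is multiplied. *)
Lemma cvg_bin_ratio s j :
  ('C(N d - s - 2, d - s - 1 - j)%:R / 'C(N d - s - 2, d - s - 1)%:R : R)
    @[d --> \oo] --> (1 : R).
Proof.
elim: j => [|j IHj].
  apply: cvg_near_cst.
  exists (s + 1)%N => // d /= sd; have := @N_ge d ltac:(lia) => dN.
  rewrite subn0 divff// pnatr_eq0 -lt0n bin_gt0; lia.
rewrite -[X in _ --> X](mulr1 1).
apply: cvg_trans (cvgM IHj (cvg_shifted_ratio (s + 1 + j) j)).
apply: near_eq_cvg; exists (s + j + 2)%N => // d /= sd.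
have := @N_ge d ltac:(lia) => dN.
have -> : (d - (s + 1 + j) = (d - s - 1 - j.+1).+1)%N by lia.
have -> : (d - s - 1 - j = (d - s - 1 - j.+1).+1)%N by lia.
set n := (N d - s - 2)%N; set a := (d - s - 1 - j.+1)%N.
have -> : (N d - d + j = n - a)%N by rewrite /n /a; lia.
have := mul_bin_left n a => /(congr1 (fun m => m%:R : R)); rewrite !natrM => E.
have C0 : 'C(n, d - s - 1)%:R != 0 :> R.
  by rewrite pnatr_eq0 -lt0n bin_gt0 /n; lia.
have na0 : (n - a)%:R != 0 :> R by rewrite pnatr_eq0 /n /a; lia.
have -> : 'C(n, a)%:R = a.+1%:R * 'C(n, a.+1)%:R / (n - a)%:R :> R.
  by rewrite E mulrAC divff// mul1r.
have gen (x y z w : R) : x * y / z / w = (y / w) * (x / z).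
  by rewrite mulrACA [y * x]mulrC [w^-1 * _]mulrC mulrA.
by rewrite /= gen.
Qed.

(** The ratio depends on [r d], the binomial sum over the next binomial. Any fixed number of top
    summands eventually exceed half that binomial each, so [r d] tends to infinity. *)
Lemma cvg_wendel_step s :
  (wendel R (N d - s - 1) (d - s - 1) / wendel R (N d - s) (d - s) : R)
    @[d --> \oo] --> (1 : R).
Proof.
pose r d := ((\sum_(i < d - s - 1) 'C(N d - s - 2, i))%N%:R /
  'C(N d - s - 2, d - s - 1)%:R : R).
have r_oo : r d @[d --> \oo] --> +oo.
  (* Half a binomial from each of [L] summands gives [r d >= L / 2], and this [L] makes [L / 2]
     exceed [A]. *)
  apply/cvgryPge => A; pose L := ((Num.truncn `|A|).+1 * 2)%N.
  have AL : A <= L%:R / 2.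
    by rewrite natrM mulfK// ltW// (le_lt_trans (ler_norm _))// truncnS_gt.
  have : \forall d \near \oo, forall j : 'I_L, 2^-1 <
      ('C(N d - s - 2, d - s - 1 - j.+1)%:R / 'C(N d - s - 2, d - s - 1)%:R : R).
    apply: filter_forall => j; apply: (cvgr_gt _ (cvg_bin_ratio s j.+1)).
    by rewrite invf_lt1// ltr1n.
  case=> m _ mP; exists (maxn m (s + L + 3)) => // d /=.
  rewrite geq_max => /andP[/mP {}mP sd].
  have : (L <= d - s - 1)%N by lia.
  move=> /(sum_bin_ge (N d - s - 2)); rewrite -(ler_nat R) => sL.
  rewrite (le_trans AL)// (@le_trans _ _ ((\sum_(j < L)
    'C(N d - s - 2, d - s - 1 - j.+1))%:R / 'C(N d - s - 2, d - s - 1)%:R))//.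
    rewrite natr_sum mulr_suml -[L in L%:R]card_ord -sumr_const mulr_suml.
    by apply: ler_sum => j _; rewrite mul1r ltW.
  by rewrite ler_wpM2r// invr_ge0.
have rV0 : (r d)^-1 @[d --> \oo] --> (0 : R).
  apply/(gtr0_cvgV0 (f := r)) => //.
  by have /cvgryPgt/(_ 0) := r_oo.
have lim : ((1 + (r d)^-1 / 2)^-1 : R) @[d --> \oo] --> ((1 + 0 / 2)^-1 : R).
  apply: cvgV; first by rewrite mul0r addr0 oner_neq0.
  have h2 : ((r d)^-1 / 2 : R) @[d --> \oo] --> (0 / 2 : R).
    by apply: cvgMr_tmp; exact: rV0.
  by apply: cvgD h2; exact: cvg_cst.
move: lim; rewrite mul0r addr0 invr1 => lim.
apply: cvg_trans lim; apply: near_eq_cvg; exists (s + 2)%N => // d /= sd.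
have := @N_ge d ltac:(lia) => dN.
have := @wendel_ratio R (N d - s - 2) (d - s - 2) ltac:(lia).
have -> : ((d - s - 2).+2 = d - s)%N by lia.
have -> : ((N d - s - 2).+2 = N d - s)%N by lia.
have -> : ((d - s - 2).+1 = d - s - 1)%N by lia.
by have -> : ((N d - s - 2).+1 = N d - s - 1)%N by lia.
Qed.

(** The quotient telescopes into [k] single steps. *)
Lemma cvg_wendel_ratio k :
  (wendel R (N d - k) (d - k) / wendel R (N d) d : R) @[d --> \oo] --> (1 : R).
Proof.
elim: k => [|k IHk].
  apply: cvg_near_cst; exists 1%N => // -[//|d] /= _.
  by rewrite !subn0 divff// gt_eqF// wendel_gt0.
rewrite -[X in _ --> X](mulr1 1).
apply: cvg_trans (cvgM (cvg_wendel_step k) IHk); apply: near_eq_cvg.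
exists k.+1 => // d /= kd; rewrite /= mulrA.
have -> : (N d - k.+1 = N d - k - 1)%N by lia.
have -> : (d - k.+1 = d - k - 1)%N by lia.
by rewrite divfK// -(subnSK kd) gt_eqF// wendel_gt0.
Qed.
End Asymptotics.

(** * Expected face numbers *)

(** General position is included so that the flip identities are equalities of sets and not merely
    almost sure. *)
Definition separable_event (R : realType) d n (A B : {set 'I_n}) :
    set (config R d n) :=
  [set x | general_position x /\ separable A B x].

Lemma separable_event_and (R : realType) d n (A B : {set 'I_n}) j :
  (#|A| < d)%N -> j \notin A -> j \notin B ->
  @separable_event R d n (j |: A) B =
  @separable_event R d n A (j |: B) `&`
  [set x : config R d n |
    @separable_event R d n A (j |: B) (flip j x)].
Proof.
move=> Ad jA jB; apply/seteqP; split=> x /=.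
  move=> [gx /(separable_flip_and gx Ad jA jB)[s1 s2]].
  by split; split=> //=; exact/general_position_flip.
move=> [[gx s1] [_ s2]]; split=> //=.
exact/(separable_flip_and gx Ad jA jB).
Qed.

Lemma separable_event_or (R : realType) d n (A B : {set 'I_n}) j :
  (#|A| < d)%N -> j \notin A -> j \notin B ->
  @separable_event R d n A B =
  @separable_event R d n A (j |: B) `|`
  [set x : config R d n |
    @separable_event R d n A (j |: B) (flip j x)].
Proof.
move=> Ad jA jB; apply/seteqP; split=> x /=.
  move=> [gx /(separable_flip_or gx Ad jA jB)[s|s]]; [left|right]; split=> //=.
  exact/general_position_flip.
move=> [[gx s]|[/= /general_position_flip gx s]]; split=> //=;
  apply/(separable_flip_or gx Ad jA jB); [by left|by right].
Qed.

Lemma measurable_preimage_flip (R : realType) d n j (S : set (config R d n)) :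
  measurable S -> measurable [set x : config R d n | S (flip j x)].
Proof. by move=> mS; have := measurable_flip j measurableT mS; rewrite setTI. Qed.

(** Equality constraints are not open, so they are removed one by one: an index of [A] moves to [B]
    at the price of intersecting with a flipped event. With [A] empty only strict inequalities
    remain. *)
Lemma measurable_separable_event (R : realType) d n (A B : {set 'I_n}) :
  (#|A| <= d)%N -> (forall i, i \in A -> i \notin B) ->
  measurable (@separable_event R d n A B).
Proof.
have [m] := ubnP #|A|; elim: m A B => // m IHm A B Am Ad dAB.
have [A0|[j jA]] := set_0Vmem A.
  rewrite [X in measurable X](_ : _ = [set x | general_position x] `&`
      [set x : config R d n |
        exists u, forall j, j \in B -> 0 < 1 * dotp u (x j)]).
    apply: measurableI; first exact: measurable_general_position.
    exact: measurable_signed_halfspaces.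
  apply/seteqP; split=> x /= [gx [u]].
    by move=> [_ uB]; split=> //; exists u => i iB; rewrite mul1r uB.
  move=> uB; split=> //; exists u; split=> [i|i /uB]; first by rewrite A0 inE.
  by rewrite mul1r.
rewrite -(finset.setD1K jA) in Am Ad dAB *; set A' := A :\ j.
have jA' : j \notin A' by rewrite !inE eqxx.
move: Am Ad dAB; rewrite cardsU1 jA' add1n => Am Ad dAB.
have jB : j \notin B by rewrite dAB// setU11.
rewrite separable_event_and//.
have mA : measurable (@separable_event R d n A' (j |: B)).
  apply: IHm => //; first exact: ltnW.
  move=> i iA'; have := dAB i; rewrite !finset.in_setU1 negb_or iA' orbT => -> //.
  by rewrite andbT; apply: contraNneq jA' => <-.
by apply: measurableI => //; exact: measurable_preimage_flip.
Qed.

(** Inclusion-exclusion for an event [S] and its equally likely flip: twice the probability of [S]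
    is that of the union plus that of the intersection, both with one index fewer in [B]. This is
    the recursion of [wendel]. *)
Lemma probability_separable_event (R : realType) d n
    (mu : probability (config R d n) R) (phi : probability (borel_rV R d) R)
    (A B : {set 'I_n}) :
  product_law mu phi -> even_measure phi -> null_on_hyperplanes phi ->
  (#|A| <= d)%N -> (forall i, i \in A -> i \notin B) ->
  mu (@separable_event R d n A B) = (wendel R #|B| (d - #|A|))%:E.
Proof.
move=> mu_phi phi_even phi0.
have [m] := ubnP #|B|; elim: m A B => // m IHm A B Bm Ad dAB.
have [B0|[j jB]] := set_0Vmem B.
  rewrite B0 cards0 /= -(probability_general_position mu_phi phi0); congr (mu _).
  apply/seteqP; split=> x /=; first by case.
  move=> gx; split=> //; exists 0; split=> i; first by rewrite dotp0l.
  by rewrite inE.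
rewrite -(finset.setD1K jB) in Bm dAB *; set B' := B :\ j.
have jB' : j \notin B' by rewrite !inE eqxx.
move: Bm dAB; rewrite cardsU1 jB' add1n => Bm dAB.
have jA : j \notin A by apply/negP => /dAB; rewrite setU11.
have dAB' i : i \in A -> i \notin B'.
  by move=> /dAB; rewrite !inE negb_or => /andP[].
move: Ad; rewrite leq_eqVlt => /orP[/eqP Ad|Ad].
  (* Vanishing on [d] independent vectors makes the functional 0, so it is not positive at [x j]. *)
  rewrite Ad subnn /= (_ : separable_event _ _ = set0) ?measure0//.
  rewrite -subset0 => x [gx [u [uA uB]]].
  have := uB j; rewrite setU11 (@interpolates_orthogonal R d n A x u)//.
    by rewrite dotp0l ltxx => /(_ isT).
  by apply: gx; rewrite Ad.
set S := @separable_event R d n A (j |: B').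
set fS := [set x : config R d n | S (flip j x)].
have mS : measurable S by apply: measurable_separable_event; [exact: ltnW|].
have mfS : measurable fS by exact: measurable_preimage_flip.
have fSE : mu fS = mu S := flip_invariance j mu_phi phi_even mS.
have dAB'' i : i \in j |: A -> i \notin B'.
  by rewrite finset.in_setU1 => /predU1P[->|/dAB'].
have cA : #|j |: A| = #|A|.+1 by rewrite cardsU1 jA.
have pU : mu (S `|` fS) = (wendel R #|B'| (d - #|A|))%:E.
  by rewrite -separable_event_or// IHm// ltnW.
have pI : mu (S `&` fS) = (wendel R #|B'| (d - #|A|.+1))%:E.
  by rewrite -separable_event_and// IHm ?cA.
have Sfin : mu S \is a fin_num by rewrite fin_num_measure.
have S_lt : (mu S < +oo)%E by rewrite -ge0_fin_numE.
have SU : mu (S `|` fS) = (mu S + mu fS - mu (S `&` fS))%E.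
  exact: measureUfinl mS mfS S_lt.
rewrite pU pI fSE -(fineK Sfin) in SU; have E := congr1 fine SU.
rewrite -(fineK Sfin) -(subnSK Ad) wendelSS (subnSK Ad); congr EFin.
by rewrite [wendel R _ (d - _)]E /=; field.
Qed.

(* [f] need not be measurable: the integral of a nonnegative function is
   defined as a supremum over simple functions below it. *)
Lemma ge0_integral_eq_off_null (R : realType) dsp (T : measurableType dsp)
    (mu : {measure set T -> \bar R}) (N : set T) (f g : T -> \bar R) :
  measurable N -> mu N = 0%E -> measurable_fun setT g ->
  (forall x, 0 <= f x)%E -> (forall x, 0 <= g x)%E ->
  (forall x, ~ N x -> f x = g x) ->
  (\int[mu]_x f x = \int[mu]_x g x)%E.
Proof.
move=> mN N0 mg f0 g0 fg; have mNC : measurable (setT `\` N) by exact: measurableD.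
have gN : (\int[mu]_x g x = \int[mu]_(x in setT `\` N) g x)%E.
  exact: ge0_negligible_integral.
apply/eqP; rewrite eq_le; apply/andP; split.
  (* A simple function below [f] lies below [g] off [N], and its integral does not see [N]. *)
  rewrite ge0_integralTE//; apply: ge_ereal_sup => _ [h /= hf <-].
  have mh : measurable_fun setT (fun x => (h x)%:E).
    by apply/measurable_EFinP; exact: measurable_funP.
  have h0 x : (0 <= (h x)%:E)%E by rewrite lee_fin.
  rewrite -integralT_nnsfun (ge0_negligible_integral mN _ mh _ N0)//.
  rewrite gN; apply: ge0_le_integral => //.
  - exact: measurable_funTS.
  - exact: measurable_funTS.
  - by move=> x [_ Nx]; rewrite -fg.
rewrite gN integral_mkcond !ge0_integralTE//; last first.
  by move=> x; apply: erestrict_ge0 => y _; exact: g0.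
(* The restriction of [g] is 0 on [N], where [f] is nonnegative, so the same [h] lies below [f]. *)
apply: le_ereal_sup => _ [h /= hg <-]; exists h => //= x.
apply: (le_trans (hg x)); rewrite patchE; case: ifPn => // /set_mem[_ Nx].
by rewrite fg.
Qed.

Lemma measure_eq_general_position (R : realType) d n
    (mu : probability (config R d n) R) (S S' : set (config R d n)) :
  mu [set x | general_position x] = 1%E -> measurable S -> measurable S' ->
  (forall x, general_position x -> S x <-> S' x) -> mu S = mu S'.
Proof.
move=> g1 mS mS' SS'.
have mg := @measurable_general_position R d n.
have g0 : mu (~` [set x | general_position x]) = 0%E.
  by rewrite probability_setC// g1 subee.
have restr A : measurable A -> mu A = mu (A `&` [set x | general_position x]).
  move=> mA; rewrite (measureDI mu mA mg) -[RHS]add0e; congr (_ + _)%E.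
  apply: (subset_measure0 _ _ _ g0); [exact: measurableD|exact: measurableC|].
  by move=> x [].
rewrite (restr _ mS) (restr _ mS'); congr (mu _).
by apply/seteqP; split=> x /= [xS gx]; split=> //; apply/SS'.
Qed.

(** Ensures that no [J] is counted off the conditioning event. An index outside [J] shows that the
    functional is nonzero. *)
Lemma separable_pos_neq_setT (R : realType) d n (J : {set 'I_n})
    (x : 'I_n -> 'rV[R]_d) : (#|J| < n)%N -> separable J (~: J) x ->
  pos x <> [set: 'rV[R]_d].
Proof.
move=> Jn [u [uJ uJC]]; apply/pos_neq_setT; exists (- u) => [|i].
  have [i iJ] : exists i, i \notin J.
    apply/existsP; rewrite -negb_forall; apply: contraL Jn => /forallP JT.
    by rewrite -leqNgt -[leqLHS]card_ord subset_leq_card//; apply/fintype.subsetP.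
  rewrite oppr_eq0; apply/eqP => u0.
  by have := uJC i; rewrite inE u0 dotp0l ltxx => /(_ iJ).
rewrite dotpNl oppr_le0; have [/uJ ->//|iJ] := boolP (i \in J).
by rewrite ltW// uJC// inE.
Qed.

Lemma independent_product_law (R : realType) d n dsp (Omega : measurableType dsp)
    (P : probability Omega R) (phi : probability (borel_rV R d) R)
    (X : 'I_n -> {mfun Omega >-> borel_rV R d})
    (V : {mfun Omega >-> config R d n}) :
  (forall w i, V w i = X i w :> 'rV[R]_d) -> mutually_independent P X ->
  (forall i, has_law P (X i) phi) -> product_law (distribution P V) phi.
Proof.
move=> VX X_indep X_law B mB.
have := X_indep finset.setT B mB.
under eq_bigr do rewrite -[P _]/(distribution P (X _) _) X_law//.
under eq_bigl do rewrite inE.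
move=> <-; rewrite /distribution /pushforward; congr (P _).
apply/seteqP; split=> w /= wB i; first by move=> _; rewrite /= -VX.
by rewrite VX; apply: wB; rewrite /= inE.
Qed.

Lemma cover_efron_face_number (R : realType) d n k dsp
    (Omega : measurableType dsp) (P : probability Omega R)
    (phi : probability (borel_rV R d) R)
    (X : 'I_n -> {mfun Omega >-> borel_rV R d}) :
  even_measure phi -> null_on_hyperplanes phi -> mutually_independent P X ->
  (forall i, has_law P (X i) phi) -> (k < d < n)%N ->
  cover_efron_expectation P X (fun C => (face_number k C)%:R) =
  ('C(n, k)%:R * (wendel R (n - k) (d - k) / wendel R n d))%:E.
Proof.
move=> phi_even phi0 X_indep X_law /andP[kd dn].
(* The joint law of the vectors, transported to [config], is a product law, so all probabilities can
   be computed there. *)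
pose v (w : Omega) : config R d n := fun i => X i w.
have mv : measurable_fun setT v by apply: measurable_config => i.
pose mV := isMeasurableFun.Build _ _ _ _ v mv.
pose V : {mfun Omega >-> config R d n} := HB.pack v mV.
pose mu : probability (config R d n) R := distribution P V.
have mu_phi : product_law mu phi by apply: independent_product_law X_indep X_law.
have g1 := probability_general_position mu_phi phi0.
have mg := @measurable_general_position R d n.
have mpreV S : measurable S -> measurable (V @^-1` S).
  by move=> mS; have := mv measurableT S mS; rewrite setTI.
have PE : P [set w | pos (v w) <> [set: 'rV[R]_d]] = (wendel R n d)%:E.
  transitivity (mu [set x | pos x <> [set: 'rV[R]_d]]) => //.
  transitivity (mu (@separable_event R d n finset.set0 [set: 'I_n])).
    apply: measure_eq_general_position => //.
    - exact: measurable_pos_neq_setT.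
    - apply: measurable_separable_event; first by rewrite cards0.
      by move=> i; rewrite inE.
    - move=> x gx /=; rewrite pos_neq_setT_separable ?(leq_ltn_trans _ dn)//.
      by split=> [|[]].
  rewrite (probability_separable_event mu_phi)// ?cards0 ?cardsT ?card_ord ?subn0//.
  by move=> i; rewrite inE.
rewrite /cover_efron_expectation /cond_expectation.
pose SJ (J : {set 'I_n}) := V @^-1` (@separable_event R d n J (~: J)).
have Jd (J : {set 'I_n}) : #|J| == k -> (#|J| <= d)%N.
  by move=> /eqP ->; exact: ltnW.
have JJ (J : {set 'I_n}) i : i \in J -> i \notin ~: J by rewrite inE negbK.
have mSJ (J : {set 'I_n}) : #|J| == k -> measurable (SJ J).
  move=> Jk; apply: mpreV; apply: measurable_separable_event; first exact: Jd.
  exact: (@JJ J).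
have PSJ (J : {set 'I_n}) : #|J| == k -> P (SJ J) = (wendel R (n - k) (d - k))%:E.
  move=> Jk; transitivity (mu (@separable_event R d n J (~: J))) => //.
  rewrite (probability_separable_event mu_phi phi_even phi0 (Jd _ Jk) (@JJ J)).
  by rewrite cardsCs finset.setCK card_ord (eqP Jk).
(* Off the null set of degenerate configurations the restricted face count equals a sum of
   indicators, which can be integrated term by term. *)
have intE : (\int[P]_(w in [set w | pos (v w) <> [set: 'rV[R]_d]])
    (face_number k (pos (v w)))%:R%:E =
    \sum_(J : {set 'I_n} | #|J| == k) P (SJ J))%E.
  pose h (J : {set 'I_n}) w : \bar R :=
    if #|J| == k then (\1_(SJ J) w)%:E else 0%E.
  have mh J : measurable_fun setT (h J).
    rewrite /h; have [Jk|_] := boolP (#|J| == k); last exact: measurable_cst.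
    by apply/measurable_EFinP; apply: measurable_indic; exact: mSJ.
  have h0 J w : (0 <= h J w)%E by rewrite /h; case: ifP; rewrite // lee_fin.
  rewrite [RHS]big_mkcond /= integral_mkcond.
  transitivity (\int[P]_w (\sum_J h J w))%E; last first.
    rewrite ge0_integral_sum//; apply: eq_bigr => J _; rewrite /h.
    have [Jk|_] := boolP (#|J| == k); last exact: integral0.
    by rewrite integral_indic ?setIT//; exact: mSJ.
  apply: (@ge0_integral_eq_off_null _ _ _ _
    (V @^-1` ~` [set x | general_position x])).
  - by apply: mpreV; exact: measurableC.
  - transitivity (mu (~` [set x | general_position x])) => //.
    by rewrite probability_setC// g1 subee.
  - exact: emeasurable_sum.
  - by move=> w; apply: erestrict_ge0 => y _; rewrite lee_fin.
  - by move=> w; apply: sume_ge0 => J _.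
  - move=> w /contrapT /= gx.
    have SJE J : (w \in SJ J) = `[< separable J (~: J) (v w) >].
      by apply/idP/asboolP => [/set_mem[]//|sJ]; apply/mem_set; split.
    rewrite patchE; case: ifPn => [_|].
      rewrite face_number_pos// natr_sum -sumEFin big_mkcond /=.
      by apply: eq_bigr => J _; rewrite /h indicE SJE; case: ifP.
    (* Where the hull is the whole space the integrand is 0, and no [J] of size [k < n] is
       separable. *)
    rewrite notin_setE => /= /contrapT posT; apply/esym/big1 => J _; rewrite /h.
    case: ifP => // /eqP Jk; rewrite indicE SJE; case: asboolP => // sJ.
    by case: (separable_pos_neq_setT _ sJ) => //; rewrite Jk (ltn_trans kd).
rewrite [X in (X / _)%E]intE [X in (_ / X)%E]PE.
rewrite (eq_bigr (fun=> (wendel R (n - k) (d - k))%:E)) => [|J Jk]; last exact: PSJ.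
have w0 : wendel R n d != 0.
  by rewrite -(ltn_predK kd) gt_eqF// wendel_gt0.
rewrite inver (negbTE w0) sumEFin sumr_const -EFinM; congr EFin.
have -> : #|[pred J : {set 'I_n} | #|J| == k]| = 'C(n, k).
  by rewrite -[n in RHS]card_ord -card_draws cardsE.
by rewrite -[X in X / _]mulr_natl mulrA.
Qed.

(** * Convergence of the normalised expected face numbers *)

Unset Implicit Arguments.

Theorem mainTheorem2 (R : realType)
    (phi : forall d : nat, probability (borel_rV R d) R)
    (phi_even : forall d : nat, even_measure (phi d))
    (phi_hyperplane : forall d : nat, null_on_hyperplanes (phi d))
    (k : nat) (k_ge1 : (1 <= k)%N)
    (N : nat -> nat)
    (N_ge : forall d : nat, (1 <= d)%N -> (d + 1 <= N d)%N)
    (N_lim : (d%:R / (N d)%:R : R) @[d --> \oo] --> (2^-1 : R))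
    (dsp : nat -> measure_display)
    (Omega : forall d : nat, measurableType (dsp d))
    (P : forall d : nat, probability (Omega d) R)
    (X : forall d : nat, 'I_(N d) -> {mfun Omega d >-> borel_rV R d})
    (X_indep : forall d : nat, mutually_independent (P d) (X d))
    (X_law : forall (d : nat) (i : 'I_(N d)), has_law (P d) (X d i) (phi d)) :
  (cover_efron_expectation (P d) (X d) (fun C => (face_number k C)%:R)
     / ('C(N d, k)%:R)%:E)%E @[d --> \oo] --> (1 : \bar R)%E.
Proof.
have lim := cvg_wendel_ratio N_ge N_lim k.
have : ((wendel R (N d - k) (d - k) / wendel R (N d) d)%:E : \bar R)
    @[d --> \oo] --> (1%:E : \bar R)%E by apply: cvg_EFin => //; exact: nearW.
(* The exact formula is available for [k < d], hence for all large [d]. *)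
apply: cvg_trans; apply: near_eq_cvg; exists k.+1 => // d /= kd.
have dN := N_ge d (leq_trans (ltn0Sn k) kd); rewrite addn1 in dN.
rewrite (@cover_efron_face_number R d (N d) k _ _ (P d) (phi d))//; last first.
  by rewrite kd.
have C0 : 'C(N d, k)%:R != 0 :> R.
  rewrite pnatr_eq0 -lt0n bin_gt0 ltnW//; exact: leq_trans kd (ltnW dN).
by rewrite inver (negbTE C0) -EFinM mulrAC mulfV// mul1r.
Qed.
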